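(* The variety of complex $3$-dimensional $\mathfrak{perm}$ superalgebras of type $(1,2)$ has dimension $4$ and has exactly $8$ irreducible components: $\overline{\mathcal{O}(\mathrm{R}_{04}^{\alpha})},\ \overline{\mathcal{O}(\mathrm{R}_{06}^{\alpha})},\ \overline{\mathcal{O}(\mathrm{R}_{09})},\ \overline{\mathcal{O}(\mathrm{R}_{15})},\ \overline{\mathcal{O}(\mathrm{R}_{17})},\ \overline{\mathcal{O}(\mathrm{R}_{19})},\ \overline{\mathcal{O}(\mathrm{R}_{22})},\ \overline{\mathcal{O}(\mathrm{R}_{24})}$. In particular, exactly $6$ superalgebras are rigid in this variety.
   Context: All algebras are over $\mathbb{C}$. A superalgebra is a $\mathbb{Z}_2$-graded algebra $A=A_0\oplus A_1$ with $A_iA_j\subseteq A_{i+j \bmod 2}$; $|x|\in\{0,1\}$ is the degree of a homogeneous $x$. It has type $(n,m)$ if $\dim A_0=n$, $\dim A_1=m$. The associator is $(x,y,z)=(xy)z-x(yz)$. A $\mathfrak{perm}$ superalgebra is a superalgebra satisfying $(x,y,z)=0$ and $x(yz)=(-1)^{|y||z|}x(zy)$ for all homogeneous $x,y,z$. Geometric setting: fix a graded space $V=V_0\oplus V_1$ of type $(n,m)$ with a homogeneous basis. Superalgebra structures on $V$ are even bilinear maps $\mu:V\times V\to V$, identified with their structure constants; those satisfying a given family of graded polynomial identities form a Zariski-closed subset (an affine variety) of this affine space. The group $GL(V_0)\times GL(V_1)$ acts by $(g*\mu)(x,y)=g\mu(g^{-1}x,g^{-1}y)$; its orbits are the isomorphism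 classes. $\mathcal{O}(A)$ denotes the orbit of (a structure representing) $A$ and $\overline{\mathcal{O}(A)}$ its Zariski closure; for a family $A^{\alpha}$, $\overline{\mathcal{O}(A^{\alpha})}$ denotes the closure of the union of the orbits of all $A^{\alpha}$ over the admissible parameters $\alpha$. A superalgebra is rigid if its orbit is open in the variety. The dimension of the variety is the maximal dimension of its irreducible components. Superalgebras of type $(1,2)$, in basis $e_1$ (even), $f_1,f_2$ (odd), listed by nonzero products (unlisted products are zero), $\alpha\in\mathbb{C}$: $\mathrm{R}_{04}^{\alpha}$: $f_1f_2=(\alpha+1)e_1,\ f_2f_1=(\alpha-1)e_1$; $\mathrm{R}_{06}^{\alpha}$: $e_1f_1=(1+\alpha)f_2,\ f_1e_1=(1-\alpha)f_2$; $\mathrm{R}_{09}$: $e_1e_1=e_1,\ f_1e_1=f_1$; $\mathrm{R}_{15}$: $e_1e_1=e_1,\ e_1f_1=f_1,\ f_1e_1=f_1,\ f_2e_1=f_2$; $\mathrm{R}_{17}$: $e_1e_1=e_1,\ e_1f_1=f_1,\ f_1e_1=f_1$; $\mathrm{R}_{19}$: $e_1e_1=e_1$; $\mathrm{R}_{22}$: $e_1e_1=e_1,\ f_1e_1=f_1,\ f_2e_1=f_2$; $\mathrm{R}_{24}$: $e_1e_1=e_1,\ e_1f_1=f_1,\ f_1e_1=f_1,\ e_1f_2=f_2,\ f_2e_1=f_2$. *)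

(* Defs.v *)
From mathcomp Require Import all_boot all_algebra.
From mathcomp Require Import reals complex mpoly.
Set Implicit Arguments. Unset Strict Implicit. Unset Printing Implicit Defensive.
Import GRing.Theory.
Local Open Scope ring_scope.

Section Super.
Variable K : fieldType.

(* Graded space V = V_0 + V_1 of type (1,2), basis b_0 = e1 (even),
   b_1 = f1, b_2 = f2 (odd). Vectors are coordinate functions. *)
Definition vec := 'I_3 -> K.
Definition parity (k : 'I_3) : bool := (k != 0 :> nat).
Definition basisv (i : 'I_3) : vec := fun k => (k == i)%:R.
Definition is_homog (x : vec) (d : bool) : Prop := forall k, parity k != d -> x k = 0.

(* structure constants: mu(b_i, b_j) = sum_k c i j k b_k *)
Definition sc := 'I_3 -> 'I_3 -> 'I_3 -> K.
Definition mulv (c : sc) (x y : vec) : vec :=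
  fun k => \sum_(i < 3) \sum_(j < 3) x i * y j * c i j k.

Definition even_sc (c : sc) : Prop :=
  forall i j k, parity k != (parity i (+) parity j) -> c i j k = 0.

Definition is_perm (c : sc) : Prop :=
  even_sc c /\
  forall (x y z : vec) (dx dy dz : bool), is_homog x dx -> is_homog y dy -> is_homog z dz ->
    mulv c (mulv c x y) z = mulv c x (mulv c y z) /\
    mulv c x (mulv c y z) = (fun k => (-1) ^+ (dy && dz) * mulv c x (mulv c z y) k).

Definition pt_of_sc (c : sc) : 'I_27 -> K :=
  fun n => c (inord (n %/ 9)) (inord ((n %/ 3) %% 3)) (inord (n %% 3)).

Definition sset := sc -> Prop.
Definition subs (A B : sset) : Prop := forall c, A c -> B c.
Definition seteq (A B : sset) : Prop := subs A B /\ subs B A.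

Definition zclosed (Z : sset) : Prop :=
  exists S : {mpoly K[27]} -> Prop,
    forall c, Z c <-> (forall p, S p -> p.@[pt_of_sc c] = 0).
Definition zclosure (A : sset) : sset :=
  fun c => forall Z, zclosed Z -> subs A Z -> Z c.
Definition closed_in (X Z : sset) : Prop :=
  exists Z', zclosed Z' /\ forall c, Z c <-> (X c /\ Z' c).
Definition open_in (X U : sset) : Prop :=
  exists Z', zclosed Z' /\ forall c, U c <-> (X c /\ ~ Z' c).

Definition irreducible (Y : sset) : Prop :=
  (exists y, Y y) /\
  forall Z1 Z2, zclosed Z1 -> zclosed Z2 ->
    (forall y, Y y -> Z1 y \/ Z2 y) -> subs Y Z1 \/ subs Y Z2.

Definition component (X Y : sset) : Prop :=
  subs Y X /\ irreducible Y /\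
  forall Y', subs Y Y' -> subs Y' X -> irreducible Y' -> subs Y' Y.

Definition has_chain (Y : sset) (n : nat) : Prop :=
  exists Z : nat -> sset,
    (forall i, (i <= n)%N -> irreducible (Z i) /\ closed_in Y (Z i)) /\
    (forall i, (i < n)%N -> subs (Z i) (Z i.+1) /\ ~ subs (Z i.+1) (Z i)).
Definition krull_dim (Y : sset) (n : nat) : Prop := has_chain Y n /\ ~ has_chain Y n.+1.

Definition variety_dim (X : sset) (n : nat) : Prop :=
  (exists Y, component X Y /\ krull_dim Y n) /\
  (forall Y, component X Y -> ~ has_chain Y n.+1).

Definition gradedGL (G : 'M[K]_3) : Prop :=
  G \in unitmx /\ forall i j : 'I_3, parity i != parity j -> G i j = 0.
Definition matv (M : 'M[K]_3) (x : vec) : vec := fun k => \sum_(i < 3) M k i * x i.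
Definition act (G : 'M[K]_3) (c : sc) : sc :=
  fun i j k => matv G (mulv c (matv (invmx G) (basisv i))
                              (matv (invmx G) (basisv j))) k.
Definition gorbit (c : sc) : sset := fun d => exists G, gradedGL G /\ d = act G c.
Definition orbit_fam (f : K -> sc) : sset := fun d => exists a, gorbit (f a) d.
Definition rigid (X : sset) (c : sc) : Prop := open_in X (gorbit c).

(* structure given by a list of nonzero products ((i, j), (k, coeff)) *)
Definition mk_sc (l : seq ('I_3 * 'I_3 * 'I_3 * K)) : sc :=
  fun i j k => \sum_(t <- l | (t.1.1.1 == i) && (t.1.1.2 == j) && (t.1.2 == k)) t.2.

Definition e1 : 'I_3 := inord 0.
Definition f1 : 'I_3 := inord 1.
Definition f2 : 'I_3 := inord 2.

Definition R04 (a : K) := mk_sc [:: (f1, f2, e1, a + 1); (f2, f1, e1, a - 1)].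
Definition R06 (a : K) := mk_sc [:: (e1, f1, f2, 1 + a); (f1, e1, f2, 1 - a)].
Definition R09 := mk_sc [:: (e1, e1, e1, 1); (f1, e1, f1, 1)].
Definition R15 := mk_sc [:: (e1, e1, e1, 1); (e1, f1, f1, 1); (f1, e1, f1, 1); (f2, e1, f2, 1)].
Definition R17 := mk_sc [:: (e1, e1, e1, 1); (e1, f1, f1, 1); (f1, e1, f1, 1)].
Definition R19 := mk_sc [:: (e1, e1, e1, 1)].
Definition R22 := mk_sc [:: (e1, e1, e1, 1); (f1, e1, f1, 1); (f2, e1, f2, 1)].
Definition R24 := mk_sc [:: (e1, e1, e1, 1); (e1, f1, f1, 1); (f1, e1, f1, 1);
                            (e1, f2, f2, 1); (f2, e1, f2, 1)].

Definition comp_gen (i : 'I_8) : sset :=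
  match val i with
  | 0 => orbit_fam R04
  | 1 => orbit_fam R06
  | 2 => gorbit R09
  | 3 => gorbit R15
  | 4 => gorbit R17
  | 5 => gorbit R19
  | 6 => gorbit R22
  | _ => gorbit R24
  end.
End Super.

(* Main.v *)
Require Import Defs.
From mathcomp Require Import all_boot all_order all_algebra.
From mathcomp Require Import reals complex mpoly ring zify boolp.
Set Implicit Arguments. Unset Strict Implicit. Unset Printing Implicit Defensive.
Import GRing.Theory Num.Theory.
Local Open Scope ring_scope.

(** An even structure is given by a scalar a (e1 e1 = a e1), two 2 x 2 matrices L, R (left and
    right multiplication of the odd part by e1) and a bilinear form B on the odd part.  The perm
    identities give L^2 = L R = R L = a L and R^2 = a R.  If a <> 0, then B = 0 and L/a, R/a are
    commuting idempotents with the image of L inside that of R, so the pair of ranks takes six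
    values: these are the six rigid algebras.  If a = 0, either L = R = 0 and B is arbitrary (an
    affine 4-space, the closure of the family R04), or B = 0 and L, R are proportional
    nilpotent matrices (the closure of the family R06).  Each of these eight closed sets is the
    image of a polynomial map from affine 4-space, hence irreducible and of dimension at most 4,
    since five polynomials in four variables are algebraically dependent.  Traces of L and R
    separate the six orbits, and an invariant ratio (det B : (b12 - b21)^2, respectively
    L : R) shows that no orbit is open in the two remaining components. *)

(** * Polynomial functions and the Zariski topology *)

Section PolynomialFunctions.
Variables (K : fieldType) (n : nat).
Implicit Types f g : ('I_n -> K) -> K.

Definition polyfun f := exists p : {mpoly K[n]}, forall t, f t = p.@[t].

Lemma polyfun_const c : polyfun (fun _ => c).
Proof. by exists c%:MP => t; rewrite mevalC. Qed.

Lemma polyfun_var i : polyfun (fun t => t i).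
Proof. by exists 'X_i => t; rewrite mevalXU. Qed.

Lemma polyfunD f g : polyfun f -> polyfun g -> polyfun (fun t => f t + g t).
Proof. by move=> [p Hp] [q Hq]; exists (p + q) => t; rewrite mevalD Hp Hq. Qed.

Lemma polyfunN f : polyfun f -> polyfun (fun t => - f t).
Proof. by move=> [p Hp]; exists (- p) => t; rewrite mevalN Hp. Qed.

Lemma polyfunM f g : polyfun f -> polyfun g -> polyfun (fun t => f t * g t).
Proof. by move=> [p Hp] [q Hq]; exists (p * q) => t; rewrite mevalM Hp Hq. Qed.

Lemma polyfunX f m : polyfun f -> polyfun (fun t => f t ^+ m).
Proof. by move=> [p Hp]; exists (p ^+ m) => t; rewrite rmorphXn Hp. Qed.

(** Along the line every coordinate is affine in s, so each monomial becomes a univariate polynomial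
    in s. *)
Lemma polyfun_line f (x y : 'I_n -> K) : polyfun f ->
  exists q : {poly K}, forall s, f (fun i => x i + s * (y i - x i)) = q.[s].
Proof.
move=> [p Hp].
exists (\sum_(m <- msupp p) (p@_m)%:P * \prod_i ((x i)%:P + (y i - x i) *: 'X) ^+ m i).
move=> s; rewrite Hp mevalE horner_sum; apply: eq_bigr => m _.
rewrite hornerM hornerC horner_prod; congr (_ * _); apply: eq_bigr => i _.
by rewrite horner_exp !hornerE mulrC.
Qed.

End PolynomialFunctions.

Ltac polyf :=
  repeat first [ apply: polyfun_const | apply: polyfun_var | apply: polyfunD
               | apply: polyfunN | apply: polyfunM | apply: polyfunX ].

Section Infinite.
Variable K : numFieldType.

(** In characteristic zero the naturals below [size p] are distinct, one more than a nonzero p can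
    have as roots. *)
Lemma poly_nonroot (p : {poly K}) : p != 0 -> exists s, p.[s] != 0.
Proof.
move=> p0; set rs := [seq i%:R : K | i <- iota 0 (size p)].
have uq : uniq rs.
  by rewrite map_inj_uniq ?iota_uniq // => i j /eqP; rewrite eqr_nat => /eqP.
case: (boolP (all (root p) rs)) => [al|/allPn[s _ Hs]]; last by exists s.
by have := max_poly_roots p0 al uq; rewrite size_map size_iota ltnn.
Qed.

(* Restrict f and g to the line through x and y. *)
Lemma polyfun_common_nonzero n (f g : ('I_n -> K) -> K) x y :
  polyfun f -> polyfun g -> f x != 0 -> g y != 0 ->
  exists t, f t != 0 /\ g t != 0.
Proof.
move=> /(polyfun_line x y)[p Hp] /(polyfun_line x y)[q Hq] fx gy.
have Ex : (fun i => x i + 0 * (y i - x i)) = x.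
  by apply: funext => i; rewrite mul0r addr0.
have Ey : (fun i => x i + 1 * (y i - x i)) = y.
  by apply: funext => i; rewrite mul1r addrC subrK.
have p0 : p != 0 by apply: contra_neq fx => p0; rewrite -Ex Hp p0 horner0.
have q0 : q != 0 by apply: contra_neq gy => q0; rewrite -Ey Hq q0 horner0.
have [s] := poly_nonroot (mulf_neq0 p0 q0).
rewrite hornerM mulf_eq0 negb_or -Hp -Hq => /andP[Hf Hg].
by exists (fun i => x i + s * (y i - x i)).
Qed.
End Infinite.

(** * Regular functions, closed sets, irreducibility and components *)

Section Zariski.
Variable K : fieldType.
Implicit Types (A B Z : sset K) (c : sc K) (F G : sc K -> K).

Definition regular F := exists p : {mpoly K[27]}, forall c, F c = p.@[pt_of_sc c].

Lemma regular_const x : regular (fun _ => x).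
Proof. by exists x%:MP => c; rewrite mevalC. Qed.

Lemma regular_coord i j k : regular (fun c => c i j k).
Proof.
(* The flat index has base-3 digits i, j, k, which [pt_of_sc] decodes. *)
exists 'X_(inord ((i * 3 + j) * 3 + k)) => c; rewrite mevalXU /pt_of_sc.
have Hi := ltn_ord i; have Hj := ltn_ord j; have Hk := ltn_ord k.
have E1 : ((i * 3 + j) * 3 + k < 27)%N.
  by move: (i : nat) (j : nat) (k : nat) Hi Hj Hk => [|[|[|]]] // [|[|[|]]] // [|[|[|]]].
rewrite inordK //.
have -> : (((i * 3 + j) * 3 + k) %/ 9 = i)%N.
  by move: (i : nat) (j : nat) (k : nat) Hi Hj Hk => [|[|[|]]] // [|[|[|]]] // [|[|[|]]].
have -> : (((i * 3 + j) * 3 + k) %/ 3 %% 3 = j)%N.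
  by move: (i : nat) (j : nat) (k : nat) Hi Hj Hk => [|[|[|]]] // [|[|[|]]] // [|[|[|]]].
have -> : (((i * 3 + j) * 3 + k) %% 3 = k)%N.
  by move: (i : nat) (j : nat) (k : nat) Hi Hj Hk => [|[|[|]]] // [|[|[|]]] // [|[|[|]]].
by rewrite !inord_val.
Qed.

Lemma regularD F G : regular F -> regular G -> regular (fun c => F c + G c).
Proof. by move=> [p Hp] [q Hq]; exists (p + q) => t; rewrite mevalD Hp Hq. Qed.

Lemma regularN F : regular F -> regular (fun c => - F c).
Proof. by move=> [p Hp]; exists (- p) => t; rewrite mevalN Hp. Qed.

Lemma regularM F G : regular F -> regular G -> regular (fun c => F c * G c).
Proof. by move=> [p Hp] [q Hq]; exists (p * q) => t; rewrite mevalM Hp Hq. Qed.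

Lemma regularX F m : regular F -> regular (fun c => F c ^+ m).
Proof. by move=> [p Hp]; exists (p ^+ m) => t; rewrite rmorphXn Hp. Qed.

Lemma zclosed_eq F G : regular F -> regular G -> zclosed (fun c => F c = G c).
Proof.
move=> [p Hp] [q Hq]; exists (fun r => r = p - q) => c; split.
  by move=> E _ ->; rewrite mevalB -Hp -Hq E subrr.
by move/(_ _ erefl)/eqP; rewrite mevalB -Hp -Hq subr_eq0 => /eqP.
Qed.

Lemma zclosed_bigcap (I : Type) (Z : I -> sset K) :
  (forall i, zclosed (Z i)) -> zclosed (fun c => forall i, Z i c).
Proof.
move=> /choice[S HS]; exists (fun p => exists i, S i p) => c; split.
  by move=> Hc p [i Sp]; exact: (proj1 (HS i c) (Hc i)).
by move=> Hc i; apply/(HS i c) => p Sp; apply: Hc; exists i.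
Qed.

Lemma zclosed_and A B : zclosed A -> zclosed B -> zclosed (fun c => A c /\ B c).
Proof.
move=> HA HB.
have [S HS] := @zclosed_bigcap bool (fun b => if b then A else B)
  (fun b => if b as b return zclosed (if b then A else B) then HA else HB).
exists S => c; rewrite -HS; split; first by case=> ? ? [].
by move=> H; split; [exact: (H true)|exact: (H false)].
Qed.

Lemma zclosed_or A B : zclosed A -> zclosed B -> zclosed (fun c => A c \/ B c).
Proof.
move=> [S HS] [T HT].
exists (fun r => exists p q, [/\ S p, T q & r = p * q]) => c; split.
  move=> [/HS Hc|/HT Hc] _ [p [q [Sp Tq ->]]]; rewrite mevalM.
    by rewrite (Hc _ Sp) mul0r.
  by rewrite (Hc _ Tq) mulr0.
move=> Hc; have [Ac|nAc] := pselect (A c); [by left|right].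
have [p [Sp p0]] : exists p, S p /\ p.@[pt_of_sc c] != 0.
  apply: contrapT => H; apply: nAc; apply/HS => p Sp.
  by apply/eqP/negPn/negP => p0; apply: H; exists p.
apply/HT => q Tq; have /eqP := Hc _ (ex_intro _ p (ex_intro _ q (And3 Sp Tq erefl))).
by rewrite mevalM mulf_eq0 (negPf p0) => /eqP.
Qed.

Lemma zclosed_false : zclosed (fun _ : sc K => False).
Proof.
exists (fun r => r = 1) => c; split=> // /(_ _ erefl)/eqP.
by rewrite meval1 oner_eq0.
Qed.

Lemma zclosed_bigcup (I : eqType) (s : seq I) (Z : I -> sset K) :
  (forall i, zclosed (Z i)) -> zclosed (fun c => exists2 i, i \in s & Z i c).
Proof.
move=> HZ; elim: s => [|i s IHs].
  by have [S HS] := zclosed_false; exists S => c; rewrite -HS; split=> // -[].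
have [S HS] := zclosed_or (HZ i) IHs; exists S => c; rewrite -HS; split.
  by move=> [j]; rewrite inE => /predU1P[->|js] Hc; [left|right; exists j].
by move=> [Hc|[j js Hc]]; [exists i|exists j]; rewrite // inE ?eqxx ?js ?orbT.
Qed.

Lemma zclosed_imply (P : Prop) A : zclosed A -> zclosed (fun c => P -> A c).
Proof.
move=> /(fun h => @zclosed_bigcap P (fun _ => A) (fun _ => h))[S HS].
by exists S.
Qed.

Lemma not_zclosed Z c : zclosed Z -> ~ Z c ->
  exists F, [/\ regular F, forall d, Z d -> F d = 0 & F c != 0].
Proof.
move=> [S HS] nZc; apply: contrapT => H; apply: nZc; apply/HS => p Sp.
apply/eqP/negPn/negP => p0; apply: H.
by exists (fun c => p.@[pt_of_sc c]); split=> //; [exists p|move=> d /HS; apply].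
Qed.

(** Density criterion: closed sets are given by equations, so the closure of [A] fills [Z] once
    every equation valid on [A] is valid on [Z]. *)
Lemma zclosure_eq A Z : zclosed Z -> subs A Z ->
  (forall F, regular F -> (forall c, A c -> F c = 0) -> forall c, Z c -> F c = 0) ->
  seteq (zclosure A) Z.
Proof.
move=> clZ AZ dense; split=> c; first by apply.
move=> Zc Z' [S HS] AZ'; apply/HS => p Sp.
apply: (dense (fun c => p.@[pt_of_sc c])) => //; first by exists p.
by move=> d /AZ' /HS; apply.
Qed.

Lemma seteq_sym A B : seteq A B -> seteq B A.
Proof. by case. Qed.

Lemma seteq_trans B A Z : seteq A B -> seteq B Z -> seteq A Z.
Proof.
by move=> [AB BA] [BZ ZB]; split=> c; [move/AB/BZ|move/ZB/BA].
Qed.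

Lemma irreducible_seteq A B : seteq A B -> irreducible A -> irreducible B.
Proof.
move=> [AB BA] [[y Ay] irr]; split; first by exists y; exact: AB.
move=> Z1 Z2 c1 c2 H.
by have [H1|H1] := irr _ _ c1 c2 (fun y Ay => H y (AB y Ay)); [left|right];
  move=> c /BA/H1.
Qed.

Lemma irreducible_subs_bigcup (I : eqType) (s : seq I) (Z : I -> sset K) A :
  irreducible A -> (forall i, zclosed (Z i)) ->
  (forall c, A c -> exists2 i, i \in s & Z i c) ->
  exists2 i, i \in s & subs A (Z i).
Proof.
move=> [[y Ay] irr] clZ; elim: s => [|i s IHs] H; first by have [] := H y Ay.
have [|Hi|/IHs[j js Hj]] := irr _ _ (clZ i) (zclosed_bigcup s clZ).
- move=> c /H[j]; rewrite inE => /predU1P[->|js] Hc; [by left|by right; exists j].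
- by exists i; rewrite ?inE ?eqxx.
- by exists j; rewrite ?inE ?js ?orbT.
Qed.

(** The regular functions on an irreducible set form a domain; this allows a nonzero factor to be
    cancelled from a relation. *)
Lemma irreducible_integral A F G : irreducible A -> regular F -> regular G ->
  (forall c, A c -> F c * G c = 0) -> (exists2 c, A c & F c != 0) ->
  forall c, A c -> G c = 0.
Proof.
move=> [_ irr] rF rG H [d Ad Fd].
have [|H0|] // := irr _ _ (zclosed_eq rF (regular_const 0)) (zclosed_eq rG (regular_const 0)).
  by move=> c /H/eqP; rewrite mulf_eq0 => /orP[]/eqP; [left|right].
by move: Fd; rewrite (H0 d Ad) eqxx.
Qed.

(** An irreducible subset of a finite union of closed sets lies in one of them, so every component
    is some [Z i]; the absence of inclusions makes each [Z i] maximal. *)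
Lemma components_of_cover (I : finType) (X : sset K) (Z : I -> sset K) :
  (forall c, X c <-> exists i, Z i c) ->
  (forall i, zclosed (Z i)) -> (forall i, irreducible (Z i)) ->
  (forall i j, subs (Z i) (Z j) -> i = j) ->
  forall Y, component X Y <-> exists i, seteq Y (Z i).
Proof.
move=> cov clZ irrZ incl Y.
have sub_some A : subs A X -> irreducible A -> exists i, subs A (Z i).
  move=> AX irrA; have [|i _ Ai] := @irreducible_subs_bigcup _ (enum I) Z A irrA clZ.
    by move=> c /AX/cov[i Zi]; exists i; rewrite ?mem_enum.
  by exists i.
split=> [[YX [irrY maxY]]|[i YZ]].
  have [i Yi] := sub_some _ YX irrY; exists i; split=> //.
  by apply: maxY => // c Zc; apply/cov; exists i.
split; first by move=> c /(proj1 YZ) Zc; apply/cov; exists i.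
split; first exact: irreducible_seteq (seteq_sym YZ) (irrZ i).
move=> Y' YY' Y'X irrY'; have [j Y'j] := sub_some _ Y'X irrY'.
have ij : i = j by apply: incl => c /(proj2 YZ)/YY'/Y'j.
by move=> c /Y'j; rewrite -ij => /(proj2 YZ).
Qed.

End Zariski.

Ltac reg :=
  repeat first [ apply: regular_const | apply: regular_coord | apply: regularD
               | apply: regularN | apply: regularM | apply: regularX ].

(** * Polynomial maps and their images *)

Section PolynomialMaps.
Variables (K : fieldType) (n : nat) (phi : ('I_n -> K) -> sc K).

Definition polymap := forall i j k, polyfun (fun t => phi t i j k).

Lemma regular_polymap F : polymap -> regular F -> polyfun (fun t => F (phi t)).
Proof.
move=> Hphi [p Hp].
have /fin_all_exists[q Hq] : forall m : 'I_27, exists q : {mpoly K[n]},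
    forall t, pt_of_sc (phi t) m = q.@[t] by move=> m; exact: Hphi.
exists (p \mPo [tuple q m | m < 27]) => t; rewrite comp_mpoly_meval Hp.
by apply: meval_eq => m; rewrite tnth_mktuple Hq.
Qed.

End PolynomialMaps.

Section Images.
Variables (K : numFieldType) (n : nat) (phi : ('I_n -> K) -> sc K).
Hypothesis Hphi : polymap phi.

(** If neither closed set contains the image, each has an equation with nonzero pullback; a
    parameter where both pullbacks are nonzero gives an image point outside both sets. *)
Lemma irreducible_image : irreducible (fun c => exists t, c = phi t).
Proof.
split; first by exists (phi (fun _ => 0)), (fun _ => 0).
move=> Z1 Z2 cl1 cl2 H; apply: contrapT => /not_orP[N1 N2].
have out Z : zclosed Z -> ~ subs (fun c => exists t, c = phi t) Z ->
    exists F t, [/\ regular F, forall d, Z d -> F d = 0 & F (phi t) != 0].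
  move=> clZ N; apply: contrapT => E; apply: N => _ [t ->].
  by apply: contrapT => /(not_zclosed clZ)[F HF]; apply: E; exists F, t.
have [F [x [rF FZ Fx]]] := out _ cl1 N1; have [G [y [rG GZ Gy]]] := out _ cl2 N2.
have [t [Ft Gt]] :=
  polyfun_common_nonzero (regular_polymap Hphi rF) (regular_polymap Hphi rG) Fx Gy.
have [/FZ E|/GZ E] := H (phi t) (ex_intro _ t erefl).
  by rewrite E eqxx in Ft.
by rewrite E eqxx in Gt.
Qed.

(** The nonvanishing locus of h is dense: otherwise h and the pullback of F would be nonzero at a
    common parameter. *)
Lemma generic_vanish (h : ('I_n -> K) -> K) F :
  polyfun h -> (exists t, h t != 0) -> regular F ->
  (forall t, h t != 0 -> F (phi t) = 0) -> forall t, F (phi t) = 0.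
Proof.
move=> ph [x hx] rF H y; apply/eqP/negPn/negP => Fy.
have [t [ht /negP[]]] := polyfun_common_nonzero ph (regular_polymap Hphi rF) hx Fy.
by apply/eqP/H.
Qed.

End Images.

(** * Chains of irreducible sets *)

(* Exponent vectors bounded by M, nested so that the last variable comes first. *)
Fixpoint expo (M k : nat) : finType :=
  if k is k'.+1 then ('I_M * expo M k')%type else unit.

Fixpoint mono (A : comNzRingType) (M k : nat) (x : nat -> A) : expo M k -> A :=
  match k return expo M k -> A with
  | 0 => fun _ => 1
  | k'.+1 => fun m => x k' ^+ m.1 * mono x m.2
  end.

Lemma card_expo M k : #|expo M k| = (M ^ k)%N.
Proof. by elim: k => [|k IHk] /=; rewrite ?card_unit // card_prod card_ord IHk expnS. Qed.

Lemma mono_morph (A B : comNzRingType) (u : {rmorphism A -> B}) M k (x : nat -> A)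
  (m : expo M k) : u (mono x m) = mono (u \o x) m.
Proof.
elim: k m => [|k IHk] m /=; first by rewrite rmorph1.
by rewrite rmorphM rmorphXn IHk.
Qed.

(* If p_1, ..., p_k are algebraically dependent on the top of a chain of irreducible
   sets where p_i vanishes on Z_(i-1) but not on Z_i, then dividing by the lowest
   power of p_k and restricting to Z_(k-1) gives a relation among p_1, ..., p_(k-1). *)
Lemma chain_independent (K : fieldType) M k (Z : nat -> sset K) (p : nat -> sc K -> K)
    (v : expo M k -> K) :
  (forall i, (i <= k)%N -> irreducible (Z i)) ->
  (forall i, (i < k)%N -> subs (Z i) (Z i.+1)) ->
  (forall i, (i < k)%N -> [/\ regular (p i), forall c, Z i c -> p i c = 0
     & exists2 c, Z i.+1 c & p i c != 0]) ->
  (forall c, Z k c -> \sum_m v m * mono (fun i => p i c) m = 0) ->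
  forall m, v m = 0.
Proof.
elim: k v => [|k IHk] v irrZ ZS Hp Hv m.
  have [[c Zc] _] := irrZ 0%N isT.
  have := Hv c Zc; rewrite (big_pred1 m) => [|m']; first by rewrite mulr1.
  by case: m' m => [] [].
have regmono k' (m' : expo M k') : (k' <= k.+1)%N -> regular (fun c => mono (fun i => p i c) m').
  elim: k' m' => [|k' IHk'] m' lek /=; first exact: regular_const.
  by apply: regularM; [apply: regularX; case: (Hp k' lek)|apply: IHk'; exact: ltnW].
have regsum (I : finType) (F : I -> sc K -> K) (P : pred I) : (forall i, regular (F i)) ->
    regular (fun c => \sum_(i | P i) F i c).
  move=> HF; rewrite (_ : (fun c => _) = (fun c => \sum_(i <- enum P) F i c)); last first.
    by apply: funext => c; rewrite big_enum.
  elim: (enum P) => [|i s IHs].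
    rewrite (_ : (fun c => _) = (fun=> 0)); first exact: regular_const.
    by apply: funext => c; rewrite big_nil.
  rewrite (_ : (fun c => _) = (fun c => F i c + \sum_(j <- s) F j c)); first exact: regularD.
  by apply: funext => c; rewrite big_cons.
(* [w h] collects the coefficients of [p k ^+ h], extended by 0 from M on. *)
pose w (h : nat) (m' : expo M k) : K := if insub h is Some h' then v (h', m') else 0.
suff w0 h : forall m', w h m' = 0.
  by case: m => h m'; move: (w0 h m'); rewrite /w valK.
clear m.
(* By strong induction the lower powers of [p k] have dropped out, so [p k ^+ h] divides the
   relation. *)
elim/ltn_ind: h => h IHh; have [hM|hM] := ltnP h M; last first.
  by move=> m'; rewrite /w insubF // ltnNge hM.
apply: IHk => [i ik|i ik|i ik|].
- by apply: irrZ; exact: leqW.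
- by apply: ZS; exact: ltnW.
- by apply: Hp; exact: ltnW.
have [rk pk0 pkn] := Hp k (leqnn _).
pose S (h' : nat) c := \sum_(m' : expo M k) w h' m' * mono (fun i => p i c) m'.
have rS h' : regular (S h').
  by apply: regsum => m'; apply: regularM; [exact: regular_const|exact: regmono].
(* [G] is the quotient of the relation by [p k ^+ h]; it vanishes on the top set by
   irreducibility. *)
pose G c := S h c + \sum_(h' < M | (h < h')%N) p k c ^+ (h' - h) * S h' c.
have rG : regular G.
  apply: regularD => //; apply: regsum => h'; apply: regularM => //; exact: regularX.
have E c : \sum_m v m * mono (fun i => p i c) m = p k c ^+ h * G c.
  transitivity (\sum_(h' < M) p k c ^+ h' * S h' c).
    transitivity (\sum_(a < M) \sum_(b : expo M k)
        v (a, b) * (p k c ^+ a * mono (fun i => p i c) b)).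
      by rewrite pair_bigA; apply: eq_bigr => -[].
    apply: eq_bigr => h' _; rewrite mulr_sumr; apply: eq_bigr => m' _.
    by rewrite /w valK mulrCA.
  rewrite (bigID (fun h' : 'I_M => (h' < h)%N)) /= big1 ?add0r; last first.
    by move=> h' lth; rewrite [S _ _]big1 ?mulr0 // => m' _; rewrite IHh // mul0r.
  rewrite (bigD1 (Ordinal hM)) ?ltnn //= /G mulrDr; congr (_ + _).
  rewrite mulr_sumr; apply: eq_big => h'.
    by rewrite -leqNgt ltn_neqAle -val_eqE eq_sym andbC.
  move=> /andP[]; rewrite -leqNgt => leh _.
  by rewrite mulrA -exprD subnKC.
have G0 : forall c, Z k.+1 c -> G c = 0.
  apply: (@irreducible_integral _ (Z k.+1) (fun c => p k c ^+ h)) => //.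
  - exact: irrZ.
  - exact: regularX.
  - by move=> c Zc; rewrite -E Hv.
  - by case: pkn => c Zc pc; exists c => //; rewrite expf_neq0.
(* On [Z k] the function [p k] vanishes, so only [S h] survives. *)
move=> c Zc; have := G0 c (ZS k (leqnn _) c Zc); rewrite /G big1 ?addr0 // => h' lth.
by rewrite pk0 // expr0n subn_eq0 leqNgt lth mul0r.
Qed.

(** * Algebraic dependence and the dimension bound *)

(** Since [msize] is the degree plus one, and 0 for the zero polynomial, the bound [a.+1] means
    degree at most a and covers zero as well. *)
Lemma msizeM_leq (K : fieldType) n (p q : {mpoly K[n]}) a b :
  (msize p <= a.+1)%N -> (msize q <= b.+1)%N -> (msize (p * q) <= (a + b).+1)%N.
Proof.
have [->|p0] := eqVneq p 0; first by rewrite mul0r msize0.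
have [->|q0] := eqVneq q 0; first by rewrite mulr0 msize0.
rewrite msizeM // => Hp Hq; rewrite -subn1 leq_subLR add1n.
by apply: leq_trans (leq_add Hp Hq) _; rewrite addSn addnS.
Qed.

Lemma msizeX_leq (K : fieldType) n (p : {mpoly K[n]}) a m :
  (msize p <= a.+1)%N -> (msize (p ^+ m) <= (m * a).+1)%N.
Proof.
move=> Hp; elim: m => [|m IHm]; first by rewrite expr0 msize1.
by rewrite exprS mulSn; exact: msizeM_leq.
Qed.

Lemma msize_mono (K : fieldType) n M k (x : nat -> {mpoly K[n]}) d (m : expo M.+1 k) :
  (forall i, (i < k)%N -> (msize (x i) <= d.+1)%N) ->
  (msize (mono x m) <= (k * (M * d)).+1)%N.
Proof.
elim: k m => [|k IHk] m Hx /=; first by rewrite msize1.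
rewrite mulSn; apply: msizeM_leq; last by apply: IHk => i ik; apply: Hx; exact: ltnW.
apply: leq_trans (msizeX_leq _ (Hx k (leqnn _))) _.
by rewrite ltnS leq_mul2r -ltnS ltn_ord orbT.
Qed.

(* For M large there are more monomials in n.+1 polynomials than coefficients of polynomials
   in n variables of the corresponding degree. *)
Lemma algebraic_dependence (K : fieldType) n (x : nat -> {mpoly K[n]}) :
  exists M (v : expo M n.+1 -> K), (exists m, v m != 0) /\
    \sum_m v m *: mono x m = 0.
Proof.
pose d := (\max_(i < n.+1) msize (x i))%N.
have Hd i : (i < n.+1)%N -> (msize (x i) <= d.+1)%N.
  by move=> ik; apply: leqW; exact: (@leq_bigmax _ (fun i : 'I_n.+1 => msize (x i)) (Ordinal ik)).
(* With this choice N <= C (M + 1), hence N ^ n <= M (M + 1) ^ n < (M + 1) ^ (n + 1). *)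
pose C := (n.+1 * d).+1; pose M := (C ^ n)%N; pose N := (n.+1 * (M * d)).+1.
have ltNM : (N ^ n < M.+1 ^ n.+1)%N.
  have leN : (N <= C * M.+1)%N.
    rewrite /N /C (mulnCA n.+1 M d).
    have aux P Q : ((Q * P).+1 <= P.+1 * Q.+1)%N by nia.
    exact: aux.
  apply: leq_ltn_trans (_ : (C * M.+1) ^ n < _)%N.
    have leX a b e : (a <= b -> a ^ e <= b ^ e)%N by case: e => // e; rewrite leq_exp2r.
    exact: leX.
  by rewrite expnMn -/M expnS ltn_mul2r expn_gt0 /= ltnS leqnn.
pose I := expo M.+1 n.+1; pose J := {ffun 'I_n -> 'I_N}.
(* Each row lists the coefficients of one monomial in the x_i. There are more rows than columns, so
   a nonzero row vector kills [A]. *)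
pose A : 'M[K]_(#|I|, #|J|) :=
  \matrix_(i, j) (mono x (enum_val i))@_[multinom ((enum_val j : J) a : nat) | a < n].
have [u u0 uA] : exists2 u : 'rV_(#|I|), u != 0 & u *m A = 0.
  have : kermx A != 0.
    rewrite -mxrank_eq0 mxrank_ker subn_eq0 -ltnNge.
    apply: leq_ltn_trans (rank_leq_col A) _.
    by rewrite /I card_expo /J card_ffun !card_ord.
  by move=> /rowV0Pn[u /sub_kermxP uA u0]; exists u.
exists M.+1, (fun m => u 0 (enum_rank m)); split.
  have /rV0Pn[i ui] := u0; exists (enum_val i); by rewrite enum_valK.
apply/mpolyP => mm; rewrite mcoeff0 raddf_sum /=.
(* The degree bound leaves no coefficient of total degree N or more; any other exponent indexes a
   column of [A]. *)
have [ltm|gem] := ltnP (mdeg mm) N; last first.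
  rewrite big1 // => m _; rewrite mcoeffZ [X in _ * X]memN_msupp_eq0 ?mulr0 //.
  apply: msize_mdeg_ge; apply: leq_trans gem; exact: msize_mono.
have lta a : (mm a < N)%N.
  apply: leq_ltn_trans ltm; rewrite mdegE (bigD1 a) //=; exact: leq_addr.
pose j : J := [ffun a => Ordinal (lta a)].
have := congr1 (fun B : 'rV_ _ => B 0 (enum_rank j)) uA; rewrite !mxE => E.
rewrite -{}[RHS]E (reindex_onto enum_val enum_rank) /=; last by move=> *; rewrite enum_rankK.
under eq_bigl do rewrite enum_valK eqxx.
apply: eq_bigr => i _; rewrite mcoeffZ enum_valK mxE; congr (_ * _@_ _).
by apply/mnmP => a; rewrite mnmE enum_rankK ffunE.
Qed.

(** The second hypothesis places Y in the closure of the image. The n + 1 steps of a chain supply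
    separating regular functions, which pull back to polynomials in n variables; their dependence,
    transported to Y, contradicts [chain_independent]. *)
Lemma no_long_chain (K : fieldType) n (phi : ('I_n -> K) -> sc K) (Y : sset K) :
  polymap phi ->
  (forall F, regular F -> (forall t, F (phi t) = 0) -> forall c, Y c -> F c = 0) ->
  ~ has_chain Y n.+1.
Proof.
move=> Hphi dom [Z [HZ HS]].
(* The guard extends the claim to every natural number, as [choice] requires. *)
have ex i : exists F, (i < n.+1)%N -> [/\ regular F, forall c, Z i c -> F c = 0
     & exists2 c, Z i.+1 c & F c != 0].
  have [ik|_] := ltnP i n.+1; last by exists (fun=> 0).
  have [irr [Z' [cl Z'E]]] := HZ i (ltnW ik).
  have [_ [Z'' [_ Z''E]]] := HZ i.+1 ik.
  have [_ N] := HS i ik.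
  have [c Zc nZc] : exists2 c, Z i.+1 c & ~ Z i c.
    apply: contrapT => E; apply: N => c Zc.
    by apply: contrapT => nZc; apply: E; exists c.
  have Yc : Y c by have /Z''E[] := Zc.
  have [|F [rF FZ Fc]] := @not_zclosed _ Z' c cl; first by move=> ?; apply: nZc; apply/Z'E.
  exists F => _; split=> //; last by exists c.
  by move=> b /Z'E[_ /FZ].
have [p Hp] := choice ex.
have rp i : exists q : {mpoly K[n]}, (i < n.+1)%N -> forall t, p i (phi t) = q.@[t].
  have [/Hp[rF _ _]|_] := ltnP i n.+1; last by exists 0.
  by have [q Hq] := regular_polymap Hphi rF; exists q.
have [x Hx] := choice rp.
have [M [v [[m vm] Hv]]] := algebraic_dependence x.
suff v0 : forall m, v m = 0 by rewrite v0 eqxx in vm.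
apply: (chain_independent (Z := Z) (p := p)) => // [i ik|i ik|].
- by have [] := HZ i ik.
- by have [] := HS i ik.
move=> c Zc.
pose F c := \sum_m v m * mono (fun i => p i c) m.
have monoE M' k (m' : expo M' k) t : (k <= n.+1)%N ->
    mono (fun i => p i (phi t)) m' = mono (fun i => (x i).@[t]) m'.
  elim: k m' => [|k IHk] m' lek //=; rewrite IHk ?(Hx k lek) //; exact: ltnW.
apply: (dom F) => [|t|]; last by have [_ [Z' [_ E]]] := HZ n.+1 (leqnn _); have /E[] := Zc.
  have exq i : exists q : {mpoly K[27]}, (i < n.+1)%N ->
      forall c, p i c = q.@[pt_of_sc c].
    have [/Hp[[q Hq] _ _]|_] := ltnP i n.+1; last by exists 0.
    by exists q.
  have [q Hq] := choice exq.
  exists (\sum_m v m *: mono q m) => b; rewrite raddf_sum; apply: eq_bigr => m' _.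
  rewrite [RHS]mevalZ; congr (_ * _).
  suff : forall k (m : expo M k), (k <= n.+1)%N ->
    mono (fun i => p i b) m = (mono q m).@[pt_of_sc b] by apply.
  elim=> [|k IHk] m1 lek /=; first by rewrite meval1.
  by rewrite mevalM rmorphXn Hq // IHk //; exact: ltnW.
rewrite /F; have := congr1 (meval t) Hv; rewrite meval0 => E; rewrite -{}[RHS]E raddf_sum.
apply: eq_bigr => m' _; rewrite [RHS]mevalZ monoE //; congr (_ * _).
by rewrite -[RHS]/(meval t (mono x m')) mono_morph.
Qed.

(** * Structure constants of type (1,2) and their orbits *)

(** Unlike the [inord] terms [e1], [f1], [f2], these indices reduce under [/=]. *)
Definition o0 : 'I_3 := @Ordinal 3 0 isT.
Definition o1 : 'I_3 := @Ordinal 3 1 isT.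
Definition o2 : 'I_3 := @Ordinal 3 2 isT.

Lemma e1E : e1 = o0. Proof. by apply: val_inj; rewrite /= inordK. Qed.
Lemma f1E : f1 = o1. Proof. by apply: val_inj; rewrite /= inordK. Qed.
Lemma f2E : f2 = o2. Proof. by apply: val_inj; rewrite /= inordK. Qed.

Lemma ord3 (P : 'I_3 -> Prop) : P o0 -> P o1 -> P o2 -> forall i, P i.
Proof.
move=> P0 P1 P2 [[|[|[|//]]] lt_i].
- by rewrite (_ : Ordinal lt_i = o0) //; apply: val_inj.
- by rewrite (_ : Ordinal lt_i = o1) //; apply: val_inj.
- by rewrite (_ : Ordinal lt_i = o2) //; apply: val_inj.
Qed.

Lemma sum3 (V : nmodType) (F : 'I_3 -> V) : \sum_(i < 3) F i = F o0 + F o1 + F o2.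
Proof.
rewrite !big_ord_recr big_ord0 /= add0r.
by congr (F _ + F _ + F _); apply: val_inj.
Qed.

Section Algebra.
Variable K : fieldType.
Implicit Type c : sc K.

Definition assocl c i j k n := \sum_m c i j m * c m k n.
Definition assocr c i j k n := \sum_m c j k m * c i m n.

Lemma mulvl c x y z n : mulv c (mulv c x y) z n =
  \sum_i \sum_j \sum_k x i * y j * z k * assocl c i j k n.
Proof.
rewrite {1}/mulv.
transitivity (\sum_m \sum_k \sum_i \sum_j x i * y j * z k * (c i j m * c m k n)).
  apply: eq_bigr => m _; apply: eq_bigr => k _; rewrite /mulv mulr_suml mulr_suml.
  apply: eq_bigr => i _; rewrite mulr_suml mulr_suml; apply: eq_bigr => j _; ring.
rewrite exchange_big /=; under eq_bigr => k _ do rewrite exchange_big /=.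
rewrite exchange_big /=; apply: eq_bigr => i _.
under eq_bigr => k _ do rewrite exchange_big /=.
rewrite exchange_big /=; apply: eq_bigr => j _; apply: eq_bigr => k _.
by rewrite mulr_sumr.
Qed.

Lemma mulvr c x y z n : mulv c x (mulv c y z) n =
  \sum_i \sum_j \sum_k x i * y j * z k * assocr c i j k n.
Proof.
rewrite {1}/mulv; apply: eq_bigr => i _.
transitivity (\sum_m \sum_j \sum_k x i * y j * z k * (c j k m * c i m n)).
  apply: eq_bigr => m _; rewrite /mulv mulr_sumr mulr_suml.
  apply: eq_bigr => j _; rewrite mulr_sumr mulr_suml; apply: eq_bigr => k _; ring.
rewrite exchange_big /=; apply: eq_bigr => j _.
by rewrite exchange_big /=; apply: eq_bigr => k _; rewrite mulr_sumr.
Qed.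

Lemma big_basis n i (F : 'I_n -> K) : \sum_j (j == i)%:R * F j = F i.
Proof.
rewrite (bigD1 i) //= eqxx mul1r big1 ?addr0 // => j /negPf ->; exact: mul0r.
Qed.

Lemma triple_basis i j k (F : 'I_3 -> 'I_3 -> 'I_3 -> K) :
  \sum_a \sum_b \sum_d basisv K i a * basisv K j b * basisv K k d * F a b d = F i j k.
Proof.
rewrite -[RHS](big_basis i (fun a => F a j k)); apply: eq_bigr => a _.
rewrite -(big_basis j (fun b => F a b k)) mulr_sumr; apply: eq_bigr => b _.
rewrite -(big_basis k (fun d => F a b d)) !mulr_sumr; apply: eq_bigr => d _.
by rewrite /basisv; ring.
Qed.

(** Both identities are multilinear, so basis vectors suffice; homogeneity kills the terms of the
    wrong parity, which makes the sign constant. *)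
Lemma is_permP c : is_perm c <-> even_sc c /\
  forall i j k n, assocl c i j k n = assocr c i j k n /\
    assocr c i j k n = (-1) ^+ (parity j && parity k) * assocr c i k j n.
Proof.
split=> -[ev H]; split=> //; [move=> i j k n|move=> x y z dx dy dz hx hy hz].
  have hom l : is_homog (basisv K l) (parity l).
    by move=> m; rewrite /basisv; have [->|_ _] := eqVneq m l; rewrite ?eqxx.
  have [E1 E2] := H _ _ _ _ _ _ (hom i) (hom j) (hom k).
  have := congr1 (fun f => f n) E1; have := congr1 (fun f => f n) E2.
  by rewrite !mulvl !mulvr !triple_basis => -> ->.
split; apply: funext => n.
  rewrite mulvl mulvr; do 3!(apply: eq_bigr => ? _).
  by rewrite (proj1 (H _ _ _ _)).
rewrite !mulvr mulr_sumr; apply: eq_bigr => i _.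
rewrite [X in _ = _ * X]exchange_big mulr_sumr; apply: eq_bigr => j _.
rewrite mulr_sumr; apply: eq_bigr => k _.
have [ej|nj] := eqVneq (parity j) dy; last by rewrite (hy j nj) !(mulr0, mul0r).
have [ek|nk] := eqVneq (parity k) dz; last by rewrite (hz k nk) !(mulr0, mul0r).
by rewrite (proj2 (H _ _ _ _)) ej ek; ring.
Qed.

(* e1 e1 = a e1, e1 fj = sum_i l_ij fi, fj e1 = sum_i r_ij fi, fi fj = b_ij e1 *)
Definition evsc (a l11 l12 l21 l22 r11 r12 r21 r22 b11 b12 b21 b22 : K) : sc K :=
  fun i j k => match val i, val j, val k with
  | 0, 0, 0 => a
  | 0, 1, 1 => l11 | 0, 2, 1 => l12 | 0, 1, 2 => l21 | 0, 2, 2 => l22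
  | 1, 0, 1 => r11 | 2, 0, 1 => r12 | 1, 0, 2 => r21 | 2, 0, 2 => r22
  | 1, 1, 0 => b11 | 1, 2, 0 => b12 | 2, 1, 0 => b21 | 2, 2, 0 => b22
  | _, _, _ => 0
  end.

Definition at_entries (P : K -> K -> K -> K -> K -> K -> K -> K -> K -> K -> K -> K -> K -> Prop) c :=
  P (c o0 o0 o0) (c o0 o1 o1) (c o0 o2 o1) (c o0 o1 o2) (c o0 o2 o2)
    (c o1 o0 o1) (c o2 o0 o1) (c o1 o0 o2) (c o2 o0 o2)
    (c o1 o1 o0) (c o1 o2 o0) (c o2 o1 o0) (c o2 o2 o0).

Lemma evsc_even a l11 l12 l21 l22 r11 r12 r21 r22 b11 b12 b21 b22 :
  even_sc (evsc a l11 l12 l21 l22 r11 r12 r21 r22 b11 b12 b21 b22).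
Proof. by move=> i j k; move: i j k; do 3!elim/ord3. Qed.

Lemma sc_ext c d : (forall i j k, c i j k = d i j k) -> c = d.
Proof. by move=> H; do 3!apply: funext => ?. Qed.

Lemma even_evsc c : even_sc c ->
  c = evsc (c o0 o0 o0) (c o0 o1 o1) (c o0 o2 o1) (c o0 o1 o2) (c o0 o2 o2)
    (c o1 o0 o1) (c o2 o0 o1) (c o1 o0 o2) (c o2 o0 o2)
    (c o1 o1 o0) (c o1 o2 o0) (c o2 o1 o0) (c o2 o2 o0).
Proof.
by move=> ev; apply: sc_ext; do 3!elim/ord3; rewrite /evsc //=; apply: ev.
Qed.

Definition gmx (t g11 g12 g21 g22 : K) : 'M[K]_3 :=
  \matrix_(i, j) match val i, val j with
  | 0, 0 => t | 1, 1 => g11 | 1, 2 => g12 | 2, 1 => g21 | 2, 2 => g22 | _, _ => 0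
  end.

Lemma mulmx_gmx t g11 g12 g21 g22 s h11 h12 h21 h22 :
  gmx t g11 g12 g21 g22 *m gmx s h11 h12 h21 h22 =
  gmx (t * s) (g11 * h11 + g12 * h21) (g11 * h12 + g12 * h22)
              (g21 * h11 + g22 * h21) (g21 * h12 + g22 * h22).
Proof.
by apply/matrixP; do 2!elim/ord3; rewrite mxE sum3 !mxE /= !(mul0r, mulr0, add0r, addr0).
Qed.

Lemma gmx1 : gmx 1 1 0 0 1 = 1%:M.
Proof. by apply/matrixP; do 2!elim/ord3; rewrite !mxE. Qed.

Lemma graded_gmx (G : 'M[K]_3) : (forall i j, parity i != parity j -> G i j = 0) ->
  G = gmx (G o0 o0) (G o1 o1) (G o1 o2) (G o2 o1) (G o2 o2).
Proof. by move=> H; apply/matrixP; do 2!elim/ord3; rewrite !mxE //= H. Qed.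

Lemma gmx_inv t g11 g12 g21 g22 (e := g11 * g22 - g12 * g21) : t != 0 -> e != 0 ->
  gmx t g11 g12 g21 g22 *m gmx t^-1 (g22 / e) (- g12 / e) (- g21 / e) (g11 / e) = 1%:M.
Proof.
by move=> t0 e0; rewrite mulmx_gmx -gmx1 /e; congr (gmx _ _ _ _ _); field.
Qed.

Lemma gradedGL_gmx (G : 'M[K]_3) : gradedGL G <->
  exists t g11 g12 g21 g22, [/\ t != 0, g11 * g22 - g12 * g21 != 0
    & G = gmx t g11 g12 g21 g22].
Proof.
split=> [[uG ev]|[t [g11 [g12 [g21 [g22 [t0 e0 ->]]]]]]]; last first.
  split; first by have [] := mulmx1_unit (gmx_inv t0 e0).
  by do 2!elim/ord3; rewrite !mxE.
have E := graded_gmx ev; exists (G o0 o0), (G o1 o1), (G o1 o2), (G o2 o1), (G o2 o2).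
set H := invmx G; have GH := mulmxV uG.
have GHe i j : G i o0 * H o0 j + G i o1 * H o1 j + G i o2 * H o2 j = (i == j)%:R.
  by have := congr1 (fun M : 'M_3 => M i j) GH; rewrite !mxE sum3.
split=> //; apply/negP => /eqP z.
  have := GHe o0 o0; rewrite z (ev o0 o1) // (ev o0 o2) // !mul0r !addr0 => /eqP.
  by rewrite eq_sym oner_eq0.
have := GHe o1 o1; have := GHe o1 o2; have := GHe o2 o1; have := GHe o2 o2.
rewrite (ev o1 o0) // (ev o2 o0) // !mul0r !add0r /= => h22 h21 h12 h11.
suff : (1 : K) = 0 by move/eqP; rewrite oner_eq0.
(* The odd blocks of G and of its inverse have determinants with product 1. *)
have -> : (1 : K) = (G o1 o1 * G o2 o2 - G o1 o2 * G o2 o1)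
   * (H o1 o1 * H o2 o2 - H o1 o2 * H o2 o1); last by rewrite z mul0r.
transitivity ((G o1 o1 * H o1 o1 + G o1 o2 * H o2 o1) * (G o2 o1 * H o1 o2 + G o2 o2 * H o2 o2)
  - (G o1 o1 * H o1 o2 + G o1 o2 * H o2 o2) * (G o2 o1 * H o1 o1 + G o2 o2 * H o2 o1)).
  by rewrite h11 h22 h12 h21; ring.
ring.
Qed.

(* L' = g L g^-1 / t, R' = g R g^-1 / t, B' = t g^-T B g^-1 *)
Definition moved t g11 g12 g21 g22 a l11 l12 l21 l22 r11 r12 r21 r22 b11 b12 b21 b22 : sc K :=
  let e := g11 * g22 - g12 * g21 in evsc (a / t)
    (((g11 * l11 + g12 * l21) * g22 - (g11 * l12 + g12 * l22) * g21) / (t * e))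
    (((g11 * l12 + g12 * l22) * g11 - (g11 * l11 + g12 * l21) * g12) / (t * e))
    (((g21 * l11 + g22 * l21) * g22 - (g21 * l12 + g22 * l22) * g21) / (t * e))
    (((g21 * l12 + g22 * l22) * g11 - (g21 * l11 + g22 * l21) * g12) / (t * e))
    (((g11 * r11 + g12 * r21) * g22 - (g11 * r12 + g12 * r22) * g21) / (t * e))
    (((g11 * r12 + g12 * r22) * g11 - (g11 * r11 + g12 * r21) * g12) / (t * e))
    (((g21 * r11 + g22 * r21) * g22 - (g21 * r12 + g22 * r22) * g21) / (t * e))
    (((g21 * r12 + g22 * r22) * g11 - (g21 * r11 + g22 * r21) * g12) / (t * e))
    (t * (b11 * g22 * g22 - b12 * g22 * g21 - b21 * g21 * g22 + b22 * g21 * g21) / e ^+ 2)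
    (t * (b12 * g22 * g11 + b21 * g21 * g12 - b11 * g22 * g12 - b22 * g21 * g11) / e ^+ 2)
    (t * (b12 * g12 * g21 + b21 * g11 * g22 - b11 * g12 * g22 - b22 * g11 * g21) / e ^+ 2)
    (t * (b11 * g12 * g12 - b12 * g12 * g11 - b21 * g11 * g12 + b22 * g11 * g11) / e ^+ 2).

Lemma act_gmx t g11 g12 g21 g22 a l11 l12 l21 l22 r11 r12 r21 r22 b11 b12 b21 b22 :
  t != 0 -> g11 * g22 - g12 * g21 != 0 ->
  act (gmx t g11 g12 g21 g22) (evsc a l11 l12 l21 l22 r11 r12 r21 r22 b11 b12 b21 b22) =
  moved t g11 g12 g21 g22 a l11 l12 l21 l22 r11 r12 r21 r22 b11 b12 b21 b22.
Proof.
move=> t0 e0; have [uG _] := mulmx1_unit (gmx_inv t0 e0).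
have iG : invmx (gmx t g11 g12 g21 g22) = gmx t^-1 (g22 / (g11 * g22 - g12 * g21))
    (- g12 / (g11 * g22 - g12 * g21)) (- g21 / (g11 * g22 - g12 * g21))
    (g11 / (g11 * g22 - g12 * g21)).
  by rewrite -[RHS](mulKmx uG) gmx_inv // mulmx1.
have mb (H : 'M[K]_3) i : matv H (basisv K i) = fun k => H k i.
  apply: funext => k; rewrite /matv -[RHS](big_basis i (fun m => H k m)).
  by apply: eq_bigr => m _; rewrite /basisv mulrC.
apply: sc_ext => i j k; rewrite /act iG !mb /matv /mulv /moved.
move: i j k; do 3!elim/ord3; rewrite /= !sum3 !mxE /evsc /= ?(mul0r, mulr0, add0r, addr0) //.
all: by field; rewrite ?t0 ?e0.
Qed.

Lemma gorbit_evsc a l11 l12 l21 l22 r11 r12 r21 r22 b11 b12 b21 b22 d :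
  gorbit (evsc a l11 l12 l21 l22 r11 r12 r21 r22 b11 b12 b21 b22) d <->
  exists t g11 g12 g21 g22, [/\ t != 0, g11 * g22 - g12 * g21 != 0
    & d = moved t g11 g12 g21 g22 a l11 l12 l21 l22 r11 r12 r21 r22 b11 b12 b21 b22].
Proof.
split=> [[G [/gradedGL_gmx[t [g11 [g12 [g21 [g22 [t0 e0 ->]]]]]] ->]]|].
  by exists t, g11, g12, g21, g22; split=> //; exact: act_gmx.
move=> [t [g11 [g12 [g21 [g22 [t0 e0 ->]]]]]].
exists (gmx t g11 g12 g21 g22); split; last by rewrite act_gmx.
by apply/gradedGL_gmx; exists t, g11, g12, g21, g22.
Qed.

Lemma gorbit_refl c : gorbit c c.
Proof.
exists 1%:M; split.
  split; first exact: unitmx1.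
  by do 2!elim/ord3; rewrite !mxE.
rewrite /act invmx1; have m1 x : matv (1%:M : 'M[K]_3) x = x.
  apply: funext => k; rewrite /matv -[RHS](big_basis k x); apply: eq_bigr => i _.
  by rewrite mxE eq_sym.
apply: sc_ext => i j k; rewrite !m1 /mulv -[LHS](big_basis i (fun a => c a j k)).
apply: eq_bigr => a _; rewrite -(big_basis j (fun b => c a b k)) mulr_sumr.
by apply: eq_bigr => b _; rewrite mulrA.
Qed.
End Algebra.

(** * The eight closed sets *)

Section Pieces.
Variable K : fieldType.

Definition null4 (w x y z : K) := w = 0 /\ x = 0 /\ y = 0 /\ z = 0.
Definition scal4 (a w x y z : K) := w = a /\ x = 0 /\ y = 0 /\ z = a.
(** Trace a and determinant 0, entries read row by row; by Cayley-Hamilton such a P satisfies P^2 =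
    a P. *)
Definition rk1 (a w x y z : K) := w + z = a /\ w * z - x * y = 0.

(* The n-th condition defines the closure of comp_gen n. *)
Definition cond (n : nat) (a l11 l12 l21 l22 r11 r12 r21 r22 b11 b12 b21 b22 : K) : Prop :=
  match n with
  | 0 => a = 0 /\ null4 l11 l12 l21 l22 /\ null4 r11 r12 r21 r22
  | 1 => a = 0 /\ null4 b11 b12 b21 b22 /\ rk1 0 l11 l12 l21 l22 /\ rk1 0 r11 r12 r21 r22
         /\ l11 * r12 = l12 * r11 /\ l11 * r21 = l21 * r11 /\ l12 * r21 = l21 * r12
  | 2 => null4 b11 b12 b21 b22 /\ null4 l11 l12 l21 l22 /\ rk1 a r11 r12 r21 r22
  | 3 => null4 b11 b12 b21 b22 /\ rk1 a l11 l12 l21 l22 /\ scal4 a r11 r12 r21 r22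
  | 4 => null4 b11 b12 b21 b22 /\ rk1 a l11 l12 l21 l22
         /\ r11 = l11 /\ r12 = l12 /\ r21 = l21 /\ r22 = l22
  | 5 => null4 b11 b12 b21 b22 /\ null4 l11 l12 l21 l22 /\ null4 r11 r12 r21 r22
  | 6 => null4 b11 b12 b21 b22 /\ null4 l11 l12 l21 l22 /\ scal4 a r11 r12 r21 r22
  | _ => null4 b11 b12 b21 b22 /\ scal4 a l11 l12 l21 l22 /\ scal4 a r11 r12 r21 r22
  end.

Definition piece (i : 'I_8) : sset K := fun c => even_sc c /\ at_entries (cond i) c.

Lemma ord8 (P : 'I_8 -> Prop) :
  P (@Ordinal 8 0 isT) -> P (@Ordinal 8 1 isT) -> P (@Ordinal 8 2 isT) ->
  P (@Ordinal 8 3 isT) -> P (@Ordinal 8 4 isT) -> P (@Ordinal 8 5 isT) ->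
  P (@Ordinal 8 6 isT) -> P (@Ordinal 8 7 isT) -> forall i, P i.
Proof.
move=> P0 P1 P2 P3 P4 P5 P6 P7 [m lt_m].
have E j (lt_j : (j < 8)%N) : j = m -> P (Ordinal lt_j) -> P (Ordinal lt_m).
  by move=> E; rewrite (_ : Ordinal lt_j = Ordinal lt_m) //; apply: val_inj.
case: m lt_m E => [|[|[|[|[|[|[|[|//]]]]]]]] lt_m E; by [exact: E P0|exact: E P1
  |exact: E P2|exact: E P3|exact: E P4|exact: E P5|exact: E P6|exact: E P7].
Qed.

Lemma zclosed_even : zclosed (@even_sc K).
Proof.
do 3!(apply: zclosed_bigcap => ?).
by apply: zclosed_imply; apply: zclosed_eq; reg.
Qed.

Lemma zclosed_piece i : zclosed (piece i).
Proof.
apply: zclosed_and; first exact: zclosed_even.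
move: i; elim/ord8; rewrite /at_entries /cond /null4 /scal4 /rk1 /=;
  repeat apply: zclosed_and; apply: zclosed_eq; reg.
Qed.

Lemma pieceP i c : piece i c <->
  exists a l11 l12 l21 l22 r11 r12 r21 r22 b11 b12 b21 b22,
  c = evsc a l11 l12 l21 l22 r11 r12 r21 r22 b11 b12 b21 b22 /\
  cond i a l11 l12 l21 l22 r11 r12 r21 r22 b11 b12 b21 b22.
Proof.
split=> [[/even_evsc E Hc]|].
  by rewrite E; do 13!eexists; split; first reflexivity.
move=> [a [l11 [l12 [l21 [l22 [r11 [r12 [r21 [r22 [b11 [b12 [b21 [b22 [-> H]]]]]]]]]]]]]].
by split; [exact: evsc_even|].
Qed.

(** Certificate for a linear consequence: k is supplied, and a polynomial identity is left to [ring]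
    or [field]. *)
Lemma lincomb1 (k A B C D : K) : A = B -> C - D = k * (A - B) -> C = D.
Proof. by move=> -> E; apply/eqP; rewrite -subr_eq0 E subrr mulr0. Qed.

Lemma lincomb2 (k A B k' A' B' C D : K) :
  A = B -> A' = B' -> C - D = k * (A - B) + k' * (A' - B') -> C = D.
Proof. by move=> -> -> E; apply/eqP; rewrite -subr_eq0 E !subrr !mulr0 addr0. Qed.

Lemma mulf_zero (x y : K) : x * y = 0 -> x = 0 \/ y = 0.
Proof. by move/eqP; rewrite mulf_eq0 => /orP[]/eqP; [left|right]. Qed.

(** If tr P = a, the first equation says det P = 0. Otherwise (tr P - a) p12 = (tr P - a) p21 = 0
    makes P diagonal with entries 0 or a, and mixed entries would give trace a. *)
Lemma idempotent2 (a p11 p12 p21 p22 : K) :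
  p11 * p11 + p12 * p21 = a * p11 -> p11 * p12 + p12 * p22 = a * p12 ->
  p21 * p11 + p22 * p21 = a * p21 -> p21 * p12 + p22 * p22 = a * p22 ->
  [\/ rk1 a p11 p12 p21 p22, null4 p11 p12 p21 p22 | scal4 a p11 p12 p21 p22].
Proof.
move=> h11 h12 h21 h22; have [tr|tr] := eqVneq (p11 + p22) a.
  constructor 1; split=> //; move: tr h11 => <- h11.
  by apply: (lincomb1 (k := -1) h11); ring.
have p12_0 : p12 = 0.
  case: (@mulf_zero (p11 + p22 - a) p12) => //.
    by apply: (lincomb1 (k := 1) h12); ring.
  by move/eqP; rewrite subr_eq0 (negPf tr).
have p21_0 : p21 = 0.
  case: (@mulf_zero (p11 + p22 - a) p21) => //.
    by apply: (lincomb1 (k := 1) h21); ring.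
  by move/eqP; rewrite subr_eq0 (negPf tr).
subst p12 p21.
have [|p11_0|p11_a] := @mulf_zero p11 (p11 - a).
  by apply: (lincomb1 (k := 1) h11); ring.
  have [|p22_0|/eqP] := @mulf_zero p22 (p22 - a).
  - by apply: (lincomb1 (k := 1) h22); ring.
  - by constructor 2; rewrite p11_0 p22_0.
  - by rewrite subr_eq0 => /eqP p22_a; move: tr; rewrite p11_0 p22_a add0r eqxx.
move/eqP: p11_a; rewrite subr_eq0 => /eqP p11_a.
have [|p22_0|/eqP] := @mulf_zero p22 (p22 - a).
- by apply: (lincomb1 (k := 1) h22); ring.
- by move: tr; rewrite p11_a p22_0 addr0 eqxx.
- by rewrite subr_eq0 => /eqP p22_a; constructor 3.
Qed.

Lemma rk1_outer (a w11 w12 w21 w22 : K) : rk1 a w11 w12 w21 w22 ->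
  exists x y z w, [/\ w11 = x * z, w12 = x * w, w21 = y * z, w22 = y * w
    & a = x * z + y * w].
Proof.
(* A nonzero corner yields the factors from the first row and column; a zero corner forces w12 w21 =
   0, so the first row or column vanishes. *)
move=> [<- det0]; have [z11|nz] := eqVneq w11 0; last first.
  have E : w22 = w21 / w11 * w12.
    by apply: (mulfI nz); apply: (lincomb1 (k := 1) det0); field.
  exists 1, (w21 / w11), w11, w12; rewrite -E.
  by split; rewrite ?mul1r //; field.
subst w11; have [|->|->] := @mulf_zero w12 w21.
- by apply: (lincomb1 (k := -1) det0); ring.
- by exists 0, 1, w21, w22; split; rewrite ?mul1r ?mul0r.
- by exists w12, w22, 0, 1; split; rewrite ?mulr1 ?mulr0.
Qed.

(* Rank-one matrices are written (x, y)^T (z, w), nilpotent ones as multiples of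
   (x, y)^T (y, -x). *)
Definition par (n : nat) (x y z w : K) : sc K :=
  match n with
  | 0 => evsc 0 0 0 0 0 0 0 0 0 x y z w
  | 1 => evsc 0 (z * (x * y)) (z * - x ^+ 2) (z * y ^+ 2) (z * - (x * y))
                (w * (x * y)) (w * - x ^+ 2) (w * y ^+ 2) (w * - (x * y)) 0 0 0 0
  | 2 => evsc (x * z + y * w) 0 0 0 0 (x * z) (x * w) (y * z) (y * w) 0 0 0 0
  | 3 => evsc (x * z + y * w) (x * z) (x * w) (y * z) (y * w)
              (x * z + y * w) 0 0 (x * z + y * w) 0 0 0 0
  | 4 => evsc (x * z + y * w) (x * z) (x * w) (y * z) (y * w)
              (x * z) (x * w) (y * z) (y * w) 0 0 0 0
  | 5 => evsc x 0 0 0 0 0 0 0 0 0 0 0 0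
  | 6 => evsc x 0 0 0 0 x 0 0 x 0 0 0 0
  | _ => evsc x x 0 0 x x 0 0 x 0 0 0 0
  end.

Lemma par_piece i x y z w : piece i (par i x y z w).
Proof.
move: i; elim/ord8; rewrite /par; (split; first exact: evsc_even);
  rewrite /at_entries /cond /null4 /scal4 /rk1 /evsc /=; repeat split=> //; ring.
Qed.

(* 2 x 2 matrices are flattened row by row: the product P Q is S. *)
Definition mul4 (p11 p12 p21 p22 q11 q12 q21 q22 s11 s12 s21 s22 : K) : Prop :=
  p11 * q11 + p12 * q21 = s11 /\ p11 * q12 + p12 * q22 = s12 /\
  p21 * q11 + p22 * q21 = s21 /\ p21 * q12 + p22 * q22 = s22.

(** With B = 0, identities with two or more odd arguments are trivial; those with one are entries of
    the four matrix equations or differences of them. *)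
Lemma evsc_perm_noB (a l11 l12 l21 l22 r11 r12 r21 r22 : K) :
  mul4 l11 l12 l21 l22 l11 l12 l21 l22 (a * l11) (a * l12) (a * l21) (a * l22) ->
  mul4 l11 l12 l21 l22 r11 r12 r21 r22 (a * l11) (a * l12) (a * l21) (a * l22) ->
  mul4 r11 r12 r21 r22 l11 l12 l21 l22 (a * l11) (a * l12) (a * l21) (a * l22) ->
  mul4 r11 r12 r21 r22 r11 r12 r21 r22 (a * r11) (a * r12) (a * r21) (a * r22) ->
  is_perm (evsc a l11 l12 l21 l22 r11 r12 r21 r22 0 0 0 0).
Proof.
move=> [LL11 [LL12 [LL21 LL22]]] [LR11 [LR12 [LR21 LR22]]] [RL11 [RL12 [RL21 RL22]]]
  [RR11 [RR12 [RR21 RR22]]].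
apply/is_permP; split; first exact: evsc_even.
rewrite /assocl /assocr; do 4!elim/ord3;
  rewrite !sum3 /evsc /= ?expr0 !(mul0r, mulr0, addr0, add0r, mul1r); split=> //.
- by apply: (lincomb1 (k := -1) LL11); ring.
- by apply: (lincomb2 (k := 1) (k' := -1) LL11 LR11); ring.
- by apply: (lincomb1 (k := -1) LL21); ring.
- by apply: (lincomb2 (k := 1) (k' := -1) LL21 LR21); ring.
- by apply: (lincomb1 (k := -1) LL12); ring.
- by apply: (lincomb2 (k := 1) (k' := -1) LL12 LR12); ring.
- by apply: (lincomb1 (k := -1) LL22); ring.
- by apply: (lincomb2 (k := 1) (k' := -1) LL22 LR22); ring.
- by apply: (lincomb2 (k := 1) (k' := -1) RL11 LR11); ring.
- by apply: (lincomb2 (k := 1) (k' := -1) LR11 LL11); ring.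
- by apply: (lincomb2 (k := 1) (k' := -1) RL21 LR21); ring.
- by apply: (lincomb2 (k := 1) (k' := -1) LR21 LL21); ring.
- by apply: (lincomb2 (k := 1) (k' := -1) RL12 LR12); ring.
- by apply: (lincomb2 (k := 1) (k' := -1) LR12 LL12); ring.
- by apply: (lincomb2 (k := 1) (k' := -1) RL22 LR22); ring.
- by apply: (lincomb2 (k := 1) (k' := -1) LR22 LL22); ring.
- by apply: (lincomb1 (k := 1) RR11); ring.
- by apply: (lincomb1 (k := 1) RR21); ring.
- by apply: (lincomb1 (k := 1) RR12); ring.
- by apply: (lincomb1 (k := 1) RR22); ring.
Qed.

(** All products lie in the line of e1, which annihilates everything, so triple products vanish. *)
Lemma evsc_perm_onlyB (b11 b12 b21 b22 : K) :
  is_perm (evsc 0 0 0 0 0 0 0 0 0 b11 b12 b21 b22).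
Proof.
apply/is_permP; split; first exact: evsc_even.
by rewrite /assocl /assocr; do 4!elim/ord3;
  rewrite !sum3 /evsc /= !(mul0r, mulr0, addr0).
Qed.

Lemma par_perm (i : 'I_8) x y z w : is_perm (par i x y z w).
Proof.
move: i; elim/ord8; rewrite /par; first exact: evsc_perm_onlyB.
all: by apply: evsc_perm_noB; rewrite /mul4; do !split; ring.
Qed.

End Pieces.

(** * Classification of the perm structures *)

Section Cover.
Variable K : numClosedFieldType.

(** Here x is a square root of - n12; if n12 = 0 then also n11 = 0, and y is a square root of
    n21. *)
Lemma nilpotent_sqrt (n11 n12 n21 n22 : K) : rk1 0 n11 n12 n21 n22 ->
  exists x y, [/\ n11 = x * y, n12 = - x ^+ 2, n21 = y ^+ 2 & n22 = - (x * y)].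
Proof.
move=> [tr det].
have E : n22 = - n11 by apply: (lincomb1 (k := 1) tr); ring.
subst n22; have [z12|nz] := eqVneq n12 0.
  subst n12; exists 0, (sqrtC n21); rewrite sqrtCK !mul0r expr0n oppr0.
  suff -> : n11 = 0 by rewrite oppr0.
  by have [||] := @mulf_zero _ n11 n11 => //; apply: (lincomb1 (k := -1) det); ring.
set x := sqrtC (- n12); have x2 : x ^+ 2 = - n12 by rewrite sqrtCK.
have x0 : x != 0 by rewrite sqrtC_eq0 oppr_eq0.
exists x, (n11 / x); rewrite x2 opprK expr_div_n x2; split=> //.
- by field.
- by apply: (mulfI nz); apply: (lincomb1 (k := -1) det); field.
- by congr (- _); field.
Qed.

(* Nonzero l or r is always available, even when L = R = 0. *)
Lemma nilpotent_pair (l11 l12 l21 l22 r11 r12 r21 r22 : K) :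
  rk1 0 l11 l12 l21 l22 -> rk1 0 r11 r12 r21 r22 ->
  l11 * r12 = l12 * r11 -> l11 * r21 = l21 * r11 -> l12 * r21 = l21 * r12 ->
  exists x y z w, [/\ z != 0 \/ w != 0,
   [/\ l11 = z * (x * y), l12 = z * - x ^+ 2, l21 = z * y ^+ 2 & l22 = z * - (x * y)] &
   [/\ r11 = w * (x * y), r12 = w * - x ^+ 2, r21 = w * y ^+ 2 & r22 = w * - (x * y)]].
Proof.
move=> L R; have [x [y [E1 E2 E3 E4]]] := nilpotent_sqrt L.
have [x' [y' [F1 F2 F3 F4]]] := nilpotent_sqrt R.
(* If L = 0, the direction is taken from R, with multipliers 0 and 1. *)
have [|] := boolP ((x == 0) && (y == 0)) => [/andP[/eqP x0 /eqP y0] _ _ _|nz].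
  exists x', y', 0, 1; split; first by right; exact: oner_neq0.
    by rewrite E1 E2 E3 E4 x0 y0; split; ring.
  by rewrite F1 F2 F3 F4; split; ring.
rewrite {}E1 {}E2 {}E3 {}E4 {L R} in nz *.
have [x0|x0] := eqVneq x 0; last first.
  (* L gets multiplier 1; that of R is read off r12, since l12 is - x ^+ 2. *)
  move=> M1 M2 M3; exists x, y, 1, (- r12 / x ^+ 2).
  split; [by left; exact: oner_neq0|by split; ring|].
  have x20 : x ^+ 2 != 0 by rewrite expf_neq0.
  have r22E : r22 = - r11 by rewrite F4 F1.
  split; last rewrite r22E.
  - by apply: (mulfI x20); apply: (lincomb1 (k := 1) M1); field.
  - by field.
  - by apply: (mulfI x20); apply: (lincomb1 (k := -1) M3); field.
  - by apply: (mulfI x20); apply: (lincomb1 (k := -1) M1); field.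
move: nz; rewrite x0 eqxx /= => y0 M1 M2 M3.
exists 0, y, 1, (r21 / y ^+ 2).
split; [by left; exact: oner_neq0|by split; ring|].
have y20 : y ^+ 2 != 0 by rewrite expf_neq0.
have r11_0 : r11 = 0.
  by apply: (mulfI y20); apply: (lincomb1 (k := -1) M2); ring.
have r12_0 : r12 = 0.
  by apply: (mulfI y20); apply: (lincomb1 (k := -1) M3); ring.
rewrite F4 -F1 r11_0 r12_0; split; [ring|ring|by field|ring].
Qed.

Lemma piece_par (i : 'I_8) c : @piece K i c -> exists x y z w, c = par i x y z w.
Proof.
move=> /pieceP[a [l11 [l12 [l21 [l22 [r11 [r12 [r21 [r22 [b11 [b12 [b21 [b22 [-> {c}]]]]]]]]]]]]]].
move: i; elim/ord8 => /=.
- move=> [-> [[-> [-> [-> ->]]] [-> [-> [-> ->]]]]]; by exists b11, b12, b21, b22.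
- move=> [-> [[-> [-> [-> ->]]] [L [R [M1 [M2 M3]]]]]].
  have [x [y [z [w [_ [-> -> -> ->] [-> -> -> ->]]]]]] := nilpotent_pair L R M1 M2 M3.
  by exists x, y, z, w.
- move=> [[-> [-> [-> ->]]] [[-> [-> [-> ->]]] R]].
  by have [x [y [z [w [-> -> -> -> ->]]]]] := rk1_outer R; exists x, y, z, w.
- move=> [[-> [-> [-> ->]]] [L [-> [-> [-> ->]]]]].
  by have [x [y [z [w [-> -> -> -> ->]]]]] := rk1_outer L; exists x, y, z, w.
- move=> [[-> [-> [-> ->]]] [L [-> [-> [-> ->]]]]].
  by have [x [y [z [w [-> -> -> -> ->]]]]] := rk1_outer L; exists x, y, z, w.
- move=> [[-> [-> [-> ->]]] [[-> [-> [-> ->]]] [-> [-> [-> ->]]]]]; by exists a, 0, 0, 0.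
- move=> [[-> [-> [-> ->]]] [[-> [-> [-> ->]]] [-> [-> [-> ->]]]]]; by exists a, 0, 0, 0.
- move=> [[-> [-> [-> ->]]] [[-> [-> [-> ->]]] [-> [-> [-> ->]]]]]; by exists a, 0, 0, 0.
Qed.

Lemma eq_opp0 (x : K) : x = - x -> x = 0.
Proof. by move/eqP; rewrite eq_sym eqNr => /eqP. Qed.

(** The relations give (R - L)^2 = a (R - L), so [idempotent2] applies to R - L. Its trace is 0,
    which excludes traces a and 2 a and leaves R = L. *)
Lemma commuting_idempotents (a l11 l12 l21 l22 r11 r12 r21 r22 : K) : a != 0 ->
  mul4 l11 l12 l21 l22 l11 l12 l21 l22 (a * l11) (a * l12) (a * l21) (a * l22) ->
  mul4 l11 l12 l21 l22 r11 r12 r21 r22 (a * l11) (a * l12) (a * l21) (a * l22) ->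
  mul4 r11 r12 r21 r22 l11 l12 l21 l22 (a * l11) (a * l12) (a * l21) (a * l22) ->
  mul4 r11 r12 r21 r22 r11 r12 r21 r22 (a * r11) (a * r12) (a * r21) (a * r22) ->
  rk1 a l11 l12 l21 l22 -> rk1 a r11 r12 r21 r22 ->
  r11 = l11 /\ r12 = l12 /\ r21 = l21 /\ r22 = l22.
Proof.
move=> a0 [LL11 [LL12 [LL21 LL22]]] [LR11 [LR12 [LR21 LR22]]]
  [RL11 [RL12 [RL21 RL22]]] [RR11 [RR12 [RR21 RR22]]] [trL _] [trR _].
have := @idempotent2 K a (r11 - l11) (r12 - l12) (r21 - l21) (r22 - l22).
have diff2 (ll lr rl rr el er : K) :
    ll = a * el -> lr = a * el -> rl = a * el -> rr = a * er ->
    rr - lr - rl + ll = a * (er - el).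
  by move=> -> -> -> ->; ring.
case.
- by rewrite -(diff2 _ _ _ _ _ _ LL11 LR11 RL11 RR11); ring.
- by rewrite -(diff2 _ _ _ _ _ _ LL12 LR12 RL12 RR12); ring.
- by rewrite -(diff2 _ _ _ _ _ _ LL21 LR21 RL21 RR21); ring.
- by rewrite -(diff2 _ _ _ _ _ _ LL22 LR22 RL22 RR22); ring.
- move=> [tr _]; move: a0; rewrite (_ : a = 0) ?eqxx // -tr.
  transitivity ((r11 + r22) - (l11 + l22)); first ring.
  by rewrite trL trR subrr.
- by move=> [/eqP + [/eqP + [/eqP + /eqP]]]; rewrite !subr_eq0 => /eqP -> /eqP -> /eqP -> /eqP ->.
move=> [s11 [_ [_ s22]]]; have : a + a = 0.
  rewrite -{1}s11 -s22; transitivity ((r11 + r22) - (l11 + l22)); first ring.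
  by rewrite trL trR subrr.
by move=> /eqP; rewrite addr_eq0 => /eqP/eq_opp0 E; rewrite E eqxx in a0.
Qed.

Ltac simp_fact H := move: H; rewrite /assocl /assocr !sum3 /evsc /=
  ?expr0 ?expr1 ?(mul0r, mulr0, addr0, add0r, mul1r).

(** The sources are (e1 e1) fj = e1 (e1 fj) = e1 (fj e1), (e1 fj) e1 = e1 (fj e1) and (fj e1) e1 =
    fj (e1 e1). *)
Lemma evsc_perm_mul a l11 l12 l21 l22 r11 r12 r21 r22 b11 b12 b21 b22 :
  is_perm (evsc a l11 l12 l21 l22 r11 r12 r21 r22 b11 b12 b21 b22 : sc K) ->
  [/\ mul4 l11 l12 l21 l22 l11 l12 l21 l22 (a * l11) (a * l12) (a * l21) (a * l22),
      mul4 l11 l12 l21 l22 r11 r12 r21 r22 (a * l11) (a * l12) (a * l21) (a * l22),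
      mul4 r11 r12 r21 r22 l11 l12 l21 l22 (a * l11) (a * l12) (a * l21) (a * l22) &
      mul4 r11 r12 r21 r22 r11 r12 r21 r22 (a * r11) (a * r12) (a * r21) (a * r22)].
Proof.
move=> /is_permP[_ H].
have [LL11 LR11] := H o0 o0 o1 o1; simp_fact LL11; simp_fact LR11 => LR11 LL11.
have [LL21 LR21] := H o0 o0 o1 o2; simp_fact LL21; simp_fact LR21 => LR21 LL21.
have [LL12 LR12] := H o0 o0 o2 o1; simp_fact LL12; simp_fact LR12 => LR12 LL12.
have [LL22 LR22] := H o0 o0 o2 o2; simp_fact LL22; simp_fact LR22 => LR22 LL22.
have [RL11 _] := H o0 o1 o0 o1; simp_fact RL11 => RL11.
have [RL21 _] := H o0 o1 o0 o2; simp_fact RL21 => RL21.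
have [RL12 _] := H o0 o2 o0 o1; simp_fact RL12 => RL12.
have [RL22 _] := H o0 o2 o0 o2; simp_fact RL22 => RL22.
have [RR11 _] := H o1 o0 o0 o1; simp_fact RR11 => RR11.
have [RR21 _] := H o1 o0 o0 o2; simp_fact RR21 => RR21.
have [RR12 _] := H o2 o0 o0 o1; simp_fact RR12 => RR12.
have [RR22 _] := H o2 o0 o0 o2; simp_fact RR22 => RR22.
rewrite -LR11 -LL11 in RL11; rewrite -LR12 -LL12 in RL12.
rewrite -LR21 -LL21 in RL21; rewrite -LR22 -LL22 in RL22.
rewrite -LL11 in LR11; rewrite -LL12 in LR12; rewrite -LL21 in LR21; rewrite -LL22 in LR22.
split; (split; [|split; [|split]]).
- by rewrite LL11; ring.
- by rewrite LL12; ring.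
- by rewrite LL21; ring.
- by rewrite LL22; ring.
- by rewrite LR11; ring.
- by rewrite LR12; ring.
- by rewrite LR21; ring.
- by rewrite LR22; ring.
- by rewrite -RL11; ring.
- by rewrite -RL12; ring.
- by rewrite -RL21; ring.
- by rewrite -RL22; ring.
- by rewrite -RR11; ring.
- by rewrite -RR12; ring.
- by rewrite -RR21; ring.
- by rewrite -RR22; ring.
Qed.

(** The sign rule for e1 (fj fk) makes B alternating. Then (f2 f1) f1 = f2 (f1 f1) gives b12 l11 =
    0, and (e1 f1) f2 = e1 (f1 f2) gives a b12 = l11 b12. *)
Lemma evsc_perm_B0 a l11 l12 l21 l22 r11 r12 r21 r22 b11 b12 b21 b22 : a != 0 ->
  is_perm (evsc a l11 l12 l21 l22 r11 r12 r21 r22 b11 b12 b21 b22 : sc K) ->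
  null4 b11 b12 b21 b22.
Proof.
move=> a0 /is_permP[_ H].
have b11_0 : b11 = 0.
  have [_ F] := H o0 o1 o1 o0; simp_fact F; rewrite mulN1r => /eq_opp0/mulf_zero[//|E].
  by rewrite E eqxx in a0.
have b22_0 : b22 = 0.
  have [_ F] := H o0 o2 o2 o0; simp_fact F; rewrite mulN1r => /eq_opp0/mulf_zero[//|E].
  by rewrite E eqxx in a0.
have b21E : b21 = - b12.
  have [_ F] := H o0 o2 o1 o0; simp_fact F; rewrite mulN1r -mulNr => E.
  exact: (mulIf a0).
subst b11 b22 b21.
have b12l11 : b12 * l11 = 0.
  have [F _] := H o2 o1 o1 o1; simp_fact F; rewrite ?mul0r mulNr => /eqP.
  by rewrite oppr_eq0 => /eqP.
have b12_0 : b12 = 0.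
  have [F _] := H o0 o1 o2 o0; simp_fact F; rewrite ?mulr0 ?addr0 mulrC b12l11 => /esym.
  by case/mulf_zero => // E; rewrite E eqxx in a0.
by rewrite b12_0 oppr0.
Qed.

(** Every entry of B times every entry of L or R vanishes, so one nonzero entry of B forces L = R =
    0. The sources are (fj fk) fh = fj (fk fh) with the sign rule, and fj (fk e1) = (fj fk) e1 =
    0. *)
Lemma evsc_perm_a0 l11 l12 l21 l22 r11 r12 r21 r22 b11 b12 b21 b22 :
  is_perm (evsc 0 l11 l12 l21 l22 r11 r12 r21 r22 b11 b12 b21 b22 : sc K) ->
  null4 b11 b12 b21 b22 \/ null4 l11 l12 l21 l22 /\ null4 r11 r12 r21 r22.
Proof.
move=> /is_permP[_]; set c := evsc _ _ _ _ _ _ _ _ _ _ _ _ _ => H.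
have ev : even_sc c by exact: evsc_even.
have odd_lr j k h n : parity j -> parity k -> parity h ->
    c j k o0 * c o0 h n = c k h o0 * c j o0 n /\
    c k h o0 * c j o0 n = - (c h k o0 * c j o0 n).
  move=> pj pk ph; have := H j k h n; rewrite /assocl /assocr !sum3 pk ph mulN1r.
  rewrite (ev j k o1) ?pj ?pk // (ev j k o2) ?pj ?pk // (ev k h o1) ?pk ?ph //.
  rewrite (ev k h o2) ?pk ?ph // (ev h k o1) ?pk ?ph // (ev h k o2) ?pk ?ph //.
  by rewrite !mul0r !addr0.
have odd_b j k : parity j -> parity k -> c k o0 o1 * c j o1 o0 + c k o0 o2 * c j o2 o0 = 0.
  move=> pj pk; have [+ _] := H j k o0 o0; rewrite /assocl /assocr !sum3.
  rewrite (ev j k o1) ?pj ?pk // (ev j k o2) ?pj ?pk // (ev k o0 o0) ?pk //.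
  by rewrite !mul0r !addr0 add0r => <-; rewrite /c /evsc /= mulr0.
have diag j k n : parity j -> parity k -> c k k o0 * c j o0 n = 0.
  by move=> pj pk; have [_ /eq_opp0] := odd_lr j k k n pj pk pk.
(* In fj (fk e1) = 0 the diagonal entries of B drop out by [diag]; the sign rule exchanges b21 for
   b12. *)
have r_b12 k n : parity k -> parity n -> c o1 o2 o0 * c k o0 n = 0.
  move=> pk; move: n; elim/ord3=> // _.
    have := odd_b o2 k isT pk; have [_ E] := odd_lr k o1 o2 o1 pk isT isT.
    by rewrite E mulrC [_ * c o2 o2 o0]mulrC diag // addr0 => ->; rewrite oppr0.
  have := odd_b o1 k isT pk.
  by rewrite mulrC diag // add0r mulrC.
have r_b j k h n : parity j -> parity k -> parity h -> parity n -> c k h o0 * c j o0 n = 0.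
  move=> pj pk ph pn; move: k pk; elim/ord3=> // _; move: h ph; elim/ord3=> // _;
    rewrite ?diag ?r_b12 //.
  by have [_ ->] := odd_lr j o2 o1 n pj isT isT; rewrite r_b12 // oppr0.
have l_b j k h n : parity j -> parity k -> parity h -> parity n -> c j k o0 * c o0 h n = 0.
  by move=> pj pk ph pn; have [-> _] := odd_lr j k h n pj pk ph; exact: r_b.
have LR0 j k : parity j -> parity k -> c j k o0 != 0 ->
    null4 l11 l12 l21 l22 /\ null4 r11 r12 r21 r22.
  move=> pj pk nz; split.
    have E h n : parity h -> parity n -> c o0 h n = 0.
      by move=> ph pn; apply: (mulfI nz); rewrite mulr0; exact: l_b.
    by split; [exact: (E o1 o1)|split; [exact: (E o2 o1)|split;
      [exact: (E o1 o2)|exact: (E o2 o2)]]].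
  have E h n : parity h -> parity n -> c h o0 n = 0.
    by move=> ph pn; apply: (mulfI nz); rewrite mulr0; exact: r_b.
  by split; [exact: (E o1 o1)|split; [exact: (E o2 o1)|split;
      [exact: (E o1 o2)|exact: (E o2 o2)]]].
have [z11|/(LR0 o1 o1 isT isT)] := eqVneq b11 0; last by right.
have [z12|/(LR0 o1 o2 isT isT)] := eqVneq b12 0; last by right.
have [z21|/(LR0 o2 o1 isT isT)] := eqVneq b21 0; last by right.
by have [z22|/(LR0 o2 o2 isT isT)] := eqVneq b22 0; [left|right].
Qed.

Lemma perm_a0_piece (c : sc K) : is_perm c -> c o0 o0 o0 = 0 ->
  piece (@Ordinal 8 0 isT) c \/ piece (@Ordinal 8 1 isT) c.
Proof.
move=> pc a0; have E := even_evsc (proj1 pc); rewrite a0 in E.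
move: E pc; move: (c o0 o1 o1) (c o0 o2 o1) (c o0 o1 o2) (c o0 o2 o2)
  (c o1 o0 o1) (c o2 o0 o1) (c o1 o0 o2) (c o2 o0 o2)
  (c o1 o1 o0) (c o1 o2 o0) (c o2 o1 o0) (c o2 o2 o0).
move=> l11 l12 l21 l22 r11 r12 r21 r22 b11 b12 b21 b22 {a0} -> pc {c}.
have [LL LR _ RR] := evsc_perm_mul pc.
have [B0|[L0 R0]] := evsc_perm_a0 pc; last by left; split; [exact: evsc_even|].
right; split; [exact: evsc_even|rewrite /at_entries /evsc /=].
have nil (p11 p12 p21 p22 : K) : mul4 p11 p12 p21 p22 p11 p12 p21 p22
    (0 * p11) (0 * p12) (0 * p21) (0 * p22) -> rk1 0 p11 p12 p21 p22.
  move=> [P11 [P12 [P21 P22]]].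
  have [//||] := idempotent2 P11 P12 P21 P22;
  by move=> [-> [-> [-> ->]]]; split; rewrite ?addr0 // !mulr0 subrr.
have L := nil _ _ _ _ LL; have R := nil _ _ _ _ RR.
move: L R => [tL dL] [tR dR].
have l22E : l22 = - l11 by apply: (lincomb1 (k := 1) tL); ring.
have r22E : r22 = - r11 by apply: (lincomb1 (k := 1) tR); ring.
subst l22 r22; case: LR => LR11 [LR12 [LR21 LR22]].
do 4!(split => //).
(* As both traces are 0, the off-diagonal entries of L R = 0 and the difference of its diagonal
   entries are the proportionality minors. *)
split; last split.
- by apply: (lincomb1 (k := 1) LR12); ring.
- by apply: (lincomb1 (k := -1) LR21); ring.
- by apply: (lincomb2 (k := 1) (k' := -1) LR11 LR22); ring.
Qed.

Lemma perm_piece (c : sc K) : is_perm c -> exists i, piece i c.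
Proof.
move=> pc; have [/(perm_a0_piece pc)[]|] := eqVneq (c o0 o0 o0) 0.
- by exists (@Ordinal 8 0 isT).
- by exists (@Ordinal 8 1 isT).
have E := even_evsc (proj1 pc).
move: E pc; move: (c o0 o0 o0) (c o0 o1 o1) (c o0 o2 o1) (c o0 o1 o2) (c o0 o2 o2)
  (c o1 o0 o1) (c o2 o0 o1) (c o1 o0 o2) (c o2 o0 o2)
  (c o1 o1 o0) (c o1 o2 o0) (c o2 o1 o0) (c o2 o2 o0).
move=> a l11 l12 l21 l22 r11 r12 r21 r22 b11 b12 b21 b22 -> pc a0 {c}.
have [LL LR RL RR] := evsc_perm_mul pc; have B0 := evsc_perm_B0 a0 pc.
suff [i Hi] : exists i : 'I_8, cond i a l11 l12 l21 l22 r11 r12 r21 r22 b11 b12 b21 b22.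
  by exists i; split; [exact: evsc_even|].
case: (LL) => [LL11 [LL12 [LL21 LL22]]]; case: (RR) => [RR11 [RR12 [RR21 RR22]]].
case: (LR) => [LR11 [LR12 [LR21 LR22]]].
(* Nine combinations of ranks: a L = L R forces L = 0 when R = 0, and R = a when L = a. *)
have [L|L|L] := idempotent2 LL11 LL12 LL21 LL22;
  have [R|R|R] := idempotent2 RR11 RR12 RR21 RR22.
- exists (@Ordinal 8 4 isT); split=> //; split=> //.
  exact: commuting_idempotents LL LR RL RR L R.
- exists (@Ordinal 8 5 isT); split=> //; split=> //.
  move: R LR11 LR12 LR21 LR22 => [-> [-> [-> ->]]]; rewrite !mulr0 addr0.
  by do 4!(move=> /esym/mulf_zero[E|->]; first by rewrite E eqxx in a0).
- by exists (@Ordinal 8 3 isT).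
- by exists (@Ordinal 8 2 isT).
- by exists (@Ordinal 8 5 isT).
- by exists (@Ordinal 8 6 isT).
all: exists (@Ordinal 8 7 isT); split=> //; split=> //.
all: move: L LR11 LR12 LR21 LR22 => [-> [-> [-> ->]]]; rewrite !mul0r !addr0 !add0r.
all: by move=> /(mulfI a0) -> /(mulfI a0) -> /(mulfI a0) -> /(mulfI a0) ->.
Qed.

Lemma permE (c : sc K) : is_perm c <-> exists i, piece i c.
Proof.
split; first exact: perm_piece.
by move=> [i /piece_par[x [y [z [w ->]]]]]; exact: par_perm.
Qed.

End Cover.

(** * Orbits and their closures *)

Section Generators.
Variable K : numClosedFieldType.
Implicit Types c d : sc K.

Lemma R04E a : R04 a = evsc 0 0 0 0 0 0 0 0 0 0 (a + 1) (a - 1) 0 :> sc K.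
Proof.
rewrite /R04 e1E f1E f2E; apply: sc_ext.
by do 3!elim/ord3; rewrite /mk_sc !big_cons big_nil /evsc /= ?addr0.
Qed.

Lemma R06E a : R06 a = evsc 0 0 0 (1 + a) 0 0 0 (1 - a) 0 0 0 0 0 :> sc K.
Proof.
rewrite /R06 e1E f1E f2E; apply: sc_ext.
by do 3!elim/ord3; rewrite /mk_sc !big_cons big_nil /evsc /= ?addr0.
Qed.

(** Meant for indices 2 to 7 only; the first two components come from families. *)
Definition gen (n : nat) : sc K :=
  match n with
  | 2 => R09 K | 3 => R15 K | 4 => R17 K | 5 => R19 K | 6 => R22 K | _ => R24 K
  end.

Lemma genE (i : 'I_8) : (1 < i)%N -> gen i = par i 1 0 1 0.
Proof.
move: i; elim/ord8 => // _; rewrite /gen /R09 /R15 /R17 /R19 /R22 /R24 e1E ?f1E ?f2E /par /=.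
all: apply: sc_ext; do 3!elim/ord3; rewrite /mk_sc !big_cons big_nil /evsc /=
  ?(mul0r, mulr0, mul1r, addr0) //.
Qed.

Lemma comp_genE (i : 'I_8) : (1 < i)%N -> comp_gen i = gorbit (gen i).
Proof. by move: i; elim/ord8. Qed.

Lemma pieceE (i : 'I_8) a l11 l12 l21 l22 r11 r12 r21 r22 b11 b12 b21 b22 :
  @piece K i (evsc a l11 l12 l21 l22 r11 r12 r21 r22 b11 b12 b21 b22) <->
  cond i a l11 l12 l21 l22 r11 r12 r21 r22 b11 b12 b21 b22.
Proof. by split=> [[]|H] //; split; first exact: evsc_even. Qed.

Lemma gorbit_gen_sub (i : 'I_8) c : (1 < i)%N -> gorbit (gen i) c ->
  piece i c /\ c o0 o0 o0 != 0.
Proof.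
move=> gt1 O; rewrite genE // in O; move: i gt1 O.
elim/ord8 => // _; rewrite /par => /gorbit_evsc[t [g11 [g12 [g21 [g22 [t0 e0 ->]]]]]];
  (split; [apply/pieceE|by rewrite /moved /evsc /= ?(mul0r, mulr0, addr0, mul1r) invr_eq0]);
  rewrite /cond /null4 /scal4 /rk1 /=; repeat split; by field; rewrite ?t0 ?e0.
Qed.

Lemma par_gorbit_gen (i : 'I_8) x y z w : (1 < i)%N -> (par i x y z w : sc K) o0 o0 o0 != 0 ->
  gorbit (gen i) (par i x y z w).
Proof.
move=> gt1; rewrite genE //; move: i gt1; elim/ord8 => // _; rewrite /par /= => a0;
  apply/gorbit_evsc.
(* The columns of g span the image and the kernel of the outer product of (x, y) and (z, w), and det
   g = x z + y w = a; the other three orbits only rescale e1. *)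
1-3: exists (x * z + y * w)^-1, x, (- w), y, z.
4-6: exists x^-1, 1, 0, 0, 1.
all: have {}a0 := a0; rewrite /evsc /= in a0.
all: split; [by rewrite invr_eq0
  |by rewrite ?mulNr ?opprK ?(mul0r, mulr0, mul1r, subr0) ?oner_neq0 // (mulrC w)
  |rewrite /moved; congr evsc; field; rewrite ?mulNr ?opprK ?(mulrC w) ?a0 ?oner_neq0 //].
Qed.
End Generators.

Section Closures.
Variable K : numClosedFieldType.
Implicit Types c d : sc K.

Lemma R04_piece c : orbit_fam (@R04 K) c -> piece (@Ordinal 8 0 isT) c.
Proof.
move=> [a]; rewrite R04E => /gorbit_evsc[t [g11 [g12 [g21 [g22 [t0 e0 ->]]]]]].
by apply/pieceE; rewrite /cond /null4; repeat split; rewrite ?(mulr0, addr0, mul0r, subrr).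
Qed.

Lemma R06_piece c : orbit_fam (@R06 K) c -> piece (@Ordinal 8 1 isT) c.
Proof.
move=> [a]; rewrite R06E => /gorbit_evsc[t [g11 [g12 [g21 [g22 [t0 e0 ->]]]]]].
apply/pieceE; rewrite /cond /null4 /rk1; repeat split; rewrite ?(mulr0, addr0, mul0r, subrr) //.
all: by field; rewrite ?t0 ?e0.
Qed.

Lemma comp_gen_piece (i : 'I_8) c : comp_gen i c -> piece i c.
Proof.
have [gt1|] := ltnP 1 i; first by rewrite comp_genE // => /(gorbit_gen_sub gt1)[].
by move: i; elim/ord8 => // _; [exact: R04_piece|exact: R06_piece].
Qed.

(** s1 and s2 are the roots of x s^2 + m s + w. *)
Lemma split_quadratic (x m w : K) : x != 0 -> m ^+ 2 - 4 * x * w != 0 ->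
  exists s1 s2, [/\ s1 != s2, m = - (x * (s1 + s2)) & w = x * s1 * s2].
Proof.
move=> x0 d0; set D := sqrtC (m ^+ 2 - 4 * x * w).
have D2 : D ^+ 2 = m ^+ 2 - 4 * x * w by rewrite sqrtCK.
have D0 : D != 0 by rewrite sqrtC_eq0.
clearbody D.
exists ((- m + D) / (2 * x)), ((- m - D) / (2 * x)); split.
- rewrite -subr_eq0; have -> : (- m + D) / (2 * x) - (- m - D) / (2 * x) = D / x.
    by field; rewrite ?x0 ?pnatr_eq0.
  by rewrite mulf_neq0 ?invr_eq0.
- by field; rewrite ?x0 ?pnatr_eq0.
- transitivity ((m ^+ 2 - D ^+ 2) / (4 * x)); first by rewrite D2; field; rewrite ?x0 ?pnatr_eq0.
  by field; rewrite ?x0 ?pnatr_eq0.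
Qed.

(* Two independent isotropic vectors (s1, 1) and (s2, 1) of a generic form give R04. *)
Lemma par0_R04 (x y z w : K) : x != 0 -> (y + z) ^+ 2 - 4 * x * w != 0 -> y != z ->
  orbit_fam (@R04 K) (par 0 x y z w).
Proof.
move=> x0 d0 yz; have [s1 [s2 [s12 mE ->]]] := split_quadratic x0 d0.
have zE : z = - (x * (s1 + s2)) - y by rewrite -mE; ring.
have s0 : s1 - s2 != 0 by rewrite subr_eq0.
have yz0 : y - z != 0 by rewrite subr_eq0.
move: yz0; rewrite {}zE {d0 yz mE s12} => yz0.
(* The two mixed values of the form on these vectors have sum - x (s1 - s2)^2 and difference (y - z)
   (s1 - s2): the quotient is the parameter, half the difference the scaling of e1. *)
exists (- (x * (s1 - s2)) / (y - (- (x * (s1 + s2)) - y))); rewrite R04E; apply/gorbit_evsc.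
exists ((y - (- (x * (s1 + s2)) - y)) * (s1 - s2) / 2), s1, s2, 1, 1; split.
- by rewrite !mulf_neq0 ?invr_eq0 ?pnatr_eq0.
- by rewrite !mulr1.
rewrite /par /moved; congr evsc; field; rewrite ?pnatr_eq0 ?andbT ?s0 //=.
all: by [].
Qed.

Lemma par1_R06 (x y z w : K) : x != 0 -> z + w != 0 ->
  orbit_fam (@R06 K) (par 1 x y z w).
Proof.
(* The parameter makes 1 + alpha and 1 - alpha proportional to z and w; g has determinant 1 and
   second column (x, y). *)
move=> x0 zw; exists ((z - w) / (z + w)); rewrite R06E; apply/gorbit_evsc.
exists (2 / (z + w)), 0, x, (- x^-1), y; split.
- by rewrite mulf_neq0 ?invr_eq0 ?pnatr_eq0.
- by rewrite mul0r sub0r mulrN opprK mulfV ?oner_neq0.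
rewrite /par /moved; congr evsc; field; rewrite ?pnatr_eq0 ?x0 ?zw //=.
all: by [].
Qed.

(** * Parametrization of the pieces by affine 4-space *)

Definition q0 : 'I_4 := @Ordinal 4 0 isT.
Definition q1 : 'I_4 := @Ordinal 4 1 isT.
Definition q2 : 'I_4 := @Ordinal 4 2 isT.
Definition q3 : 'I_4 := @Ordinal 4 3 isT.

Definition pt4 (x y z w : K) : 'I_4 -> K :=
  fun i => match val i with 0 => x | 1 => y | 2 => z | _ => w end.

Definition phi (i : 'I_8) (t : 'I_4 -> K) : sc K := par i (t q0) (t q1) (t q2) (t q3).

Lemma phi_pt4 i x y z w : phi i (pt4 x y z w) = par i x y z w.
Proof. by []. Qed.

Lemma polymap_phi i : polymap (phi i).
Proof.
move: i; elim/ord8; rewrite /phi /par; do 3!elim/ord3; rewrite /evsc /=; polyf.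
Qed.

Lemma piece_phi i c : piece i c <-> exists t, c = phi i t.
Proof.
split=> [/piece_par[x [y [z [w ->]]]]|[t ->]]; first by exists (pt4 x y z w).
exact: par_piece.
Qed.

Lemma irreducible_piece i : irreducible (@piece K i).
Proof.
apply: irreducible_seteq (irreducible_image (polymap_phi i)).
by split=> c; [move=> ?; apply/piece_phi|move/piece_phi].
Qed.

(** This gives density: the generating orbits contain the image of a nonempty open set of
    parameters. *)
Lemma comp_gen_generic (i : 'I_8) : exists h, [/\ polyfun h, exists t, h t != 0
  & forall t, h t != 0 -> comp_gen i (phi i t)].
Proof.
have [gt1|] := ltnP 1 i.
  exists (fun t => phi i t o0 o0 o0); split; first exact: polymap_phi.
    exists (pt4 1 0 1 0); rewrite phi_pt4; move: i gt1; elim/ord8 => // _;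
    by rewrite /par /evsc /= ?(mulr1, mul0r, addr0) oner_neq0.
  by move=> t a0; rewrite comp_genE //; exact: par_gorbit_gen.
move: i; elim/ord8 => // _.
- exists (fun t => t q0 * ((t q1 + t q2) ^+ 2 - 4 * t q0 * t q3) * (t q1 - t q2)).
  split; first by polyf.
    exists (pt4 1 1 0 0); rewrite /pt4 /= !(mulr0, addr0, subr0, mulr1, expr1n).
    exact: oner_neq0.
  move=> t; rewrite !mulf_eq0 !negb_or => /andP[/andP[x0 d0] yz].
  by apply: par0_R04 => //; rewrite -subr_eq0.
- exists (fun t => t q0 * (t q2 + t q3)); split; first by polyf.
    by exists (pt4 1 0 1 0); rewrite /pt4 /= addr0 mulr1 oner_neq0.
  by move=> t; rewrite mulf_eq0 negb_or => /andP[x0 zw]; exact: par1_R06.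
Qed.

Lemma zclosure_comp_gen (i : 'I_8) : seteq (zclosure (@comp_gen K i)) (piece i).
Proof.
apply: zclosure_eq; [exact: zclosed_piece|by move=> c; exact: comp_gen_piece|].
move=> F rF F0 c /piece_phi[t ->]; have [h [ph nz H]] := comp_gen_generic i.
by apply: (generic_vanish (polymap_phi i) ph nz rF) => u /H; exact: F0.
Qed.

(** The lists hold the ranks of L and R; their first two entries are placeholders, as the first two
    pieces have a = 0. *)
Lemma piece_trace (i : 'I_8) c : piece i c -> c o0 o0 o0 != 0 ->
  [/\ (1 < i)%N,
      c o0 o1 o1 + c o0 o2 o2 = (nth 0 [:: 0; 0; 0; 1; 1; 0; 0; 2] i)%N%:R * c o0 o0 o0
    & c o1 o0 o1 + c o2 o0 o2 = (nth 0 [:: 0; 0; 1; 2; 1; 0; 2; 2] i)%N%:R * c o0 o0 o0].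
Proof.
move=> /pieceP[a [l11 [l12 [l21 [l22 [r11 [r12 [r21 [r22 [b11 [b12 [b21 [b22 [-> {c}]]]]]]]]]]]]]].
move: i; elim/ord8; rewrite /evsc /=.
- by move=> [-> _]; rewrite eqxx.
- by move=> [-> _]; rewrite eqxx.
- by move=> [_ [[-> [_ [_ ->]]] [-> _]]]; split=> //; ring.
- by move=> [_ [[-> _] [-> [_ [_ ->]]]]]; split=> //; ring.
- by move=> [_ [[E _] [-> [_ [_ ->]]]]]; rewrite E; split=> //; ring.
- by move=> [_ [[-> [_ [_ ->]]] [-> [_ [_ ->]]]]]; split=> //; ring.
- by move=> [_ [[-> [_ [_ ->]]] [-> [_ [_ ->]]]]]; split=> //; ring.
- by move=> [_ [[-> [_ [_ ->]]] [-> [_ [_ ->]]]]]; split=> //; ring.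
Qed.

Lemma piece_disjoint (i j : 'I_8) c : c o0 o0 o0 != 0 -> piece i c -> piece j c -> i = j.
Proof.
move=> a0 /piece_trace/(_ a0)[i1 Li Ri] /piece_trace/(_ a0)[j1].
rewrite Li Ri => /(mulIf a0)/eqP; rewrite eqr_nat => + /(mulIf a0)/eqP; rewrite eqr_nat.
by move: i j i1 j1 {Li Ri}; do 2!elim/ord8.
Qed.

Lemma piece_incl (i j : 'I_8) : subs (@piece K i) (piece j) -> i = j.
Proof.
move=> ij; have [gt1|] := ltnP 1 i.
  have [P a0] := gorbit_gen_sub gt1 (gorbit_refl (gen K i)).
  exact: piece_disjoint a0 P (ij _ P).
have n10 : (1 : K) <> 0 by move/eqP; rewrite oner_eq0.
have n10' : (-1 : K) <> 0 by move/eqP; rewrite oppr_eq0 oner_eq0.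
have n11 : (1 : K) <> -1 by move/eq_opp0.
move: i ij; elim/ord8 => // ij _.
- have := ij _ (par_piece _ 1 0 0 0); rewrite /par /=.
  by move: j {ij}; elim/ord8 => // /pieceE /=; rewrite /null4; tauto.
(* A point with R = - L nonzero and nilpotent lies in no other piece. *)
- have := ij _ (par_piece _ 1 0 1 (-1)); rewrite /par /=.
  by move: j {ij}; elim/ord8 => // /pieceE /=;
    rewrite /null4 /scal4 expr1n !(mulr1, mul1r, mulN1r, opprK); tauto.
Qed.

End Closures.

(** * Dimension and rigidity *)

Section Main.
Variable K : numClosedFieldType.
Implicit Types c d : sc K.

Lemma component_piece Y : component (@is_perm K) Y <-> exists i, seteq Y (piece i).
Proof.
apply: components_of_cover.
- exact: permE.
- exact: zclosed_piece.
- exact: irreducible_piece.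
- exact: piece_incl.
Qed.

(** Parametrizes a coordinate flag in the 4-space of bilinear forms. *)
Definition flag (n : nat) (t : 'I_4 -> K) : sc K :=
  evsc 0 0 0 0 0 0 0 0 0 (if (0 < n)%N then t q0 else 0) (if (1 < n)%N then t q1 else 0)
    (if (2 < n)%N then t q2 else 0) (if (3 < n)%N then t q3 else 0).

Lemma has_chain_piece0 : has_chain (@piece K (@Ordinal 8 0 isT)) 4.
Proof.
exists (fun n c => exists t, c = flag n t); split=> i.
  move=> _; split.
    apply: irreducible_image.
    by do 3!elim/ord3; rewrite /flag /evsc /=; try case: (_ < i)%N; polyf.
  exists (fun c => (~~ (0 < i)%N -> c o1 o1 o0 = 0) /\
    ((~~ (1 < i)%N -> c o1 o2 o0 = 0) /\ ((~~ (2 < i)%N -> c o2 o1 o0 = 0) /\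
    (~~ (3 < i)%N -> c o2 o2 o0 = 0)))); split.
    apply: zclosed_and; [|apply: zclosed_and; [|apply: zclosed_and]].
    1-4: by apply: zclosed_imply; apply: zclosed_eq; reg.
  move=> c; split.
    move=> [t ->]; have P : piece (@Ordinal 8 0 isT) (flag i t) by exact: par_piece.
    by split=> //; rewrite /flag /evsc /=; do ?split; by move=> /negPf ->.
  move=> [Pc]; have [x [y [z [w ->]]]] := piece_par Pc; move=> [Z0 [Z1 [Z2 Z3]]].
  exists (pt4 x y z w); rewrite /flag /par /pt4 /=.
  move: Z0 Z1 Z2 Z3; rewrite /par /evsc /=.
  by case: (0 < i)%N => [_|->//]; case: (1 < i)%N => [_|->//];
     case: (2 < i)%N => [_|->//]; case: (3 < i)%N => [_|->//].
move=> lti; split.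
  move=> _ [t ->].
  exists (pt4 (if (0 < i)%N then t q0 else 0) (if (1 < i)%N then t q1 else 0)
    (if (2 < i)%N then t q2 else 0) (if (3 < i)%N then t q3 else 0)).
  by rewrite /flag /pt4 /=; case: i lti => [|[|[|[|]]]].
move=> /(_ (flag i.+1 (fun => 1)) (ex_intro _ _ erefl)) [t].
have n10 : (1 : K) <> 0 by move/eqP; rewrite oner_eq0.
by case: i lti => [|[|[|[|//]]]] _ E; apply: n10;
  [move: (congr1 (fun c => c o1 o1 o0) E)|move: (congr1 (fun c => c o1 o2 o0) E)
  |move: (congr1 (fun c => c o2 o1 o0) E)|move: (congr1 (fun c => c o2 o2 o0) E)].
Qed.

Lemma component_no_chain Y : component (@is_perm K) Y -> ~ has_chain Y 5.
Proof.
move=> /component_piece[i YE]; apply: (@no_long_chain _ 4 (phi i) Y); first exact: polymap_phi.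
by move=> F _ F0 c /(proj1 YE)/piece_phi[t ->].
Qed.

Lemma perm_variety_dim : variety_dim (@is_perm K) 4.
Proof.
split; last exact: component_no_chain.
have comp0 : component (@is_perm K) (piece (@Ordinal 8 0 isT)).
  by apply/component_piece; exists (@Ordinal 8 0 isT); split.
exists (piece (@Ordinal 8 0 isT)); split=> //; split; first exact: has_chain_piece0.
exact: component_no_chain.
Qed.

(** * Rigid superalgebras *)

Lemma gorbit_genE (i : 'I_8) c : (1 < i)%N ->
  gorbit (gen K i) c <-> piece i c /\ c o0 o0 o0 != 0.
Proof.
move=> gt1; split; first exact: gorbit_gen_sub.
by move=> [/piece_par[x [y [z [w ->]]]]]; exact: par_gorbit_gen.
Qed.

(** The complement of the orbit is cut out by a = 0 together with the other seven pieces, since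
    pieces meet only where a = 0. *)
Lemma rigid_gen (i : 'I_8) : (1 < i)%N -> rigid (@is_perm K) (gen K i).
Proof.
move=> gt1.
exists (fun c => c o0 o0 o0 = 0 \/ exists2 j, j \in [seq j <- enum 'I_8 | j != i] & piece j c).
split.
  by apply: zclosed_or; [apply: zclosed_eq; reg|apply: zclosed_bigcup; exact: zclosed_piece].
move=> c; rewrite gorbit_genE //; split.
  move=> [Pi a0]; split; first by apply/permE; exists i.
  move=> [/eqP|[j]]; first by rewrite (negPf a0).
  by rewrite mem_filter => /andP[/eqP ji _] Pj; apply: ji; exact: piece_disjoint Pj Pi.
move=> [/permE[j Pj] /not_orP[/eqP a0 N]]; split=> //.
have [<-//|ji] := eqVneq j i.
by case: N; exists j => //; rewrite mem_filter ji mem_enum.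
Qed.

(** An open orbit that meets an irreducible set is dense in it, so a closed condition on the orbit
    holds throughout. *)
Lemma rigid_dense (X Y V : sset K) c : irreducible Y -> subs Y X -> Y c ->
  rigid X c -> zclosed V -> subs (gorbit c) V -> subs Y V.
Proof.
move=> [_ irr] YX Yc [Z [clZ HZ]] clV OV.
have [d Yd||//] := irr Z V clZ clV.
  have [Zd|nZd] := pselect (Z d); [by left|right].
  by apply: OV; apply/HZ; split=> //; exact: YX.
by move=> YZ; have [_ []] := proj1 (HZ c) (gorbit_refl c); exact: YZ.
Qed.

Lemma piece_perm (i : 'I_8) : subs (@piece K i) (@is_perm K).
Proof. by move=> c Pc; apply/permE; exists i. Qed.

(* The ratio det B : (b12 - b21)^2 is constant on orbits but not on the component. *)
Lemma piece0_not_rigid c : piece (@Ordinal 8 0 isT) c -> ~ rigid (@is_perm K) c.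
Proof.
move=> Pc rc; have [x [y [z [w cE]]]] := piece_par Pc.
have dense V := @rigid_dense _ _ V c (irreducible_piece K (@Ordinal 8 0 isT))
  (@piece_perm (@Ordinal 8 0 isT)) Pc rc.
have n10 : (1 : K) <> 0 by move/eqP; rewrite oner_eq0.
(* If the form is symmetric the ratio is undefined, and symmetry itself is the invariant closed
   condition. *)
have [yz|yz] := eqVneq y z.
  apply: n10; apply: (dense (fun d => d o1 o2 o0 = d o2 o1 o0) _ _ _
    (par_piece (@Ordinal 8 0 isT) 0 1 0 0)); first by apply: zclosed_eq; reg.
  move=> d; rewrite cE yz => /gorbit_evsc[t [g11 [g12 [g21 [g22 [t0 e0 ->]]]]]].
  by rewrite /moved /evsc /=; congr (_ / _); ring.
(* The ratio is cleared of denominators. The identity form has determinant 1 and no skew part, so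
   the equation collapses to (y - z)^2 = 0. *)
have := dense (fun d => (d o1 o1 o0 * d o2 o2 o0 - d o1 o2 o0 * d o2 o1 o0) * (y - z) ^+ 2
   = (x * w - y * z) * (d o1 o2 o0 - d o2 o1 o0) ^+ 2) _ _ _
    (par_piece (@Ordinal 8 0 isT) 1 0 0 1).
rewrite /par /evsc /= !mulr1 subrr expr0n mulr0 mulr0 subr0 mul1r => E.
suff /eqP : (y - z) ^+ 2 = 0 by rewrite expf_eq0 subr_eq0 (negPf yz).
apply: E; first by apply: zclosed_eq; reg.
move=> d; rewrite cE => /gorbit_evsc[t [g11 [g12 [g21 [g22 [t0 e0 ->]]]]]].
by rewrite /moved /evsc /=; field; rewrite ?e0.
Qed.

(* L and R are proportional, in a ratio that is constant on orbits but not on the component. *)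
Lemma piece1_not_rigid c : piece (@Ordinal 8 1 isT) c -> ~ rigid (@is_perm K) c.
Proof.
move=> Pc rc; have := Pc; move/pieceP.
move=> [a [l11 [l12 [l21 [l22 [r11 [r12 [r21 [r22 [b11 [b12 [b21 [b22 [cE]]]]]]]]]]]]]].
move=> [a0 [[z1 [z2 [z3 z4]]] [L [R [M1 [M2 M3]]]]]].
have [x [y [z [w [zw [E1 E2 E3 E4] [F1 F2 F3 F4]]]]]] := nilpotent_pair L R M1 M2 M3.
rewrite {}a0 {}z1 {}z2 {}z3 {}z4 {}E1 {}E2 {}E3 {}E4 {}F1 {}F2 {}F3 {}F4 in cE.
have dense := @rigid_dense _ _ (fun d => w * d o0 o2 o1 = z * d o2 o0 o1) c
  (irreducible_piece K (@Ordinal 8 1 isT)) (@piece_perm (@Ordinal 8 1 isT)) Pc rc.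
have {}dense : subs (piece (@Ordinal 8 1 isT)) (fun d => w * d o0 o2 o1 = z * d o2 o0 o1).
  apply: dense; first by apply: zclosed_eq; reg.
  move=> d; rewrite cE => /gorbit_evsc[t [g11 [g12 [g21 [g22 [t0 e0 ->]]]]]].
  by rewrite /moved /evsc /=; field; rewrite ?t0 ?e0.
(* Points with R = 0 and with L = 0 force w = 0 and z = 0, against the choice of multipliers. *)
have := dense _ (par_piece (@Ordinal 8 1 isT) 1 0 1 0).
have := dense _ (par_piece (@Ordinal 8 1 isT) 1 0 0 1).
rewrite /par /evsc /= expr1n !(mul0r, mulr0, mul1r, mulrN1).
by move=> /esym/eqP + /eqP; rewrite !oppr_eq0 => /eqP z0 /eqP w0; case: zw; rewrite ?z0 ?w0 eqxx.
Qed.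

Lemma rigid_perm c : is_perm c -> rigid (@is_perm K) c ->
  exists2 i : 'I_8, (1 < i)%N & gorbit (gen K i) c.
Proof.
move=> pc rc; have [a0|a0] := eqVneq (c o0 o0 o0) 0.
  have [P|P] := perm_a0_piece pc a0; first by case: (piece0_not_rigid P).
  by case: (piece1_not_rigid P).
have [i Pi] := perm_piece pc; have [gt1 _ _] := piece_trace Pi a0.
by exists i => //; apply/gorbit_genE.
Qed.

Lemma perm_rigid_superalgebras : exists s : 'I_6 -> sc K,
  (forall i, is_perm (s i) /\ rigid (@is_perm K) (s i)) /\
  (forall i j, gorbit (s i) (s j) -> i = j) /\
  (forall c, is_perm c -> rigid (@is_perm K) c -> exists i, gorbit (s i) c).
Proof.
(* The shift by two skips the two families. *)
have lt8 (i : 'I_6) : (i.+2 < 8)%N by case: i.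
pose sh (i : 'I_6) := Ordinal (lt8 i).
have P i : piece (sh i) (gen K (sh i)) /\ gen K (sh i) o0 o0 o0 != 0.
  by apply/gorbit_genE => //; exact: gorbit_refl.
exists (fun i => gen K (sh i)); split; [|split].
- move=> i; split; first by apply/permE; exists (sh i); case: (P i).
  exact: rigid_gen.
- move=> i j /gorbit_genE[//|Pij a0]; have [Pj _] := P j.
  by have [/val_inj] := congr1 val (piece_disjoint a0 Pij Pj).
- move=> c pc rc; have [[[|[|i]] // lti] _ O] := rigid_perm pc rc.
  have lti6 : (i < 6)%N by [].
  by exists (Ordinal lti6).
Qed.

Theorem perm_superalgebras_1_2 :
  let X := @is_perm K in
  variety_dim X 4 /\
  (forall Y, component X Y <-> exists i : 'I_8, seteq Y (zclosure (@comp_gen K i))) /\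
  (forall i j : 'I_8, seteq (zclosure (@comp_gen K i)) (zclosure (@comp_gen K j)) -> i = j) /\
  (exists s : 'I_6 -> sc K,
     (forall i, X (s i) /\ rigid X (s i)) /\
     (forall i j, gorbit (s i) (s j) -> i = j) /\
     (forall c, X c -> rigid X c -> exists i, gorbit (s i) c)).
Proof.
have zc := @zclosure_comp_gen K.
split; first exact: perm_variety_dim.
split; [|split; last exact: perm_rigid_superalgebras].
- move=> Y; rewrite component_piece; split=> -[i YE]; exists i.
    exact: seteq_trans YE (seteq_sym (zc i)).
  exact: seteq_trans YE (zc i).
- move=> i j E; apply: piece_incl => c.
  by move/(proj2 (zc i))/(proj1 E)/(proj1 (zc j)).
Qed.
End Main.

(* K = C = R[i] for the real numbers R. *)
Theorem mainTheorem5 (R : realType) :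
  let X := @is_perm (complex R) in
  variety_dim X 4 /\
  (forall Y, component X Y <-> exists i : 'I_8, seteq Y (zclosure (@comp_gen (complex R) i))) /\
  (forall i j : 'I_8, seteq (zclosure (@comp_gen (complex R) i)) (zclosure (@comp_gen (complex R) j)) -> i = j) /\
  (exists s : 'I_6 -> sc (complex R),
     (forall i, X (s i) /\ rigid X (s i)) /\
     (forall i j, gorbit (s i) (s j) -> i = j) /\
     (forall c, X c -> rigid X c -> exists i, gorbit (s i) c)).
Proof. exact: perm_superalgebras_1_2. Qed.
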